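(* Let $R>0$ and let $w$ be a pseudo-definite weight function on the disc $D_R$ whose Fourier coefficients satisfy the summability condition $$\|w\|:=\sum_{k=0}^\infty\sum_{\ell=1}^{a_k}\int_0^R|w_{(k,\ell)}(r)|\,r\,dr<\infty .$$ Then for each continuous function $f$ on the closed disc of radius $R$, the discrete polyharmonic cubature $I^{\mathrm{poly}}_{(N,M,K)}(f)$ converges to $I_w(f)=\int_{D_R}f(x)w(x)\,dx$ when $N,M,K$ tend to infinity.
   Context: Points of the plane are written $re^{i\varphi}=(r\cos\varphi,r\sin\varphi)$; $D_R=\{x^2+y^2<R^2\}$. Put $a_0=1$, $a_k=2$ for $k\ge1$, $Y_{(0,1)}(\varphi)=1/\sqrt{2\pi}$, and for $k\ge1$: $Y_{(k,1)}(\varphi)=\frac1{\sqrt\pi}\cos k\varphi$, $Y_{(k,2)}(\varphi)=\frac1{\sqrt\pi}\sin k\varphi$. The weight $w$ is a real-valued function on $D_R$ (not necessarily non-negative), continuous except possibly at $0$. Its Fourier coefficients are $w_{(k,\ell)}(r)=\int_0^{2\pi}w(re^{i\varphi})Y_{(k,\ell)}(\varphi)\,d\varphi$ for $0<r<R$. It is called pseudo-definite if for each $(k,\ell)$ either $w_{(k,\ell)}(r)\ge0$ for all $r\in(0,R)$ or $w_{(k,\ell)}(r)\le0$ for all $r\in(0,R)$. Standing assumption: each $w_{(k,\ell)}$ is continuous on $(0,R)$ and $\int_0^R|w_{(k,\ell)}(r)|\,r\,dr<\infty$. For integers $N\ge1$, and each $(k,\ell)$ with $w_{(k,\ell)}\not\equiv0$,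 the numbers $t_{1,(k,\ell)}<\dots<t_{N,(k,\ell)}$ in $(0,R^2)$ and $\lambda_{1,(k,\ell)},\dots,\lambda_{N,(k,\ell)}$ (all of the same sign; all depending on $N$) are the nodes and weights of the $N$-point Gauss quadrature for $\rho^{k/2}w_{(k,\ell)}(\sqrt\rho)\,d\rho$ on $[0,R^2]$, i.e. $$\sum_{j=1}^N\lambda_{j,(k,\ell)}t_{j,(k,\ell)}^{s}=\int_0^{R^2}\rho^s\,\rho^{k/2}w_{(k,\ell)}(\sqrt\rho)\,d\rho\qquad(0\le s\le 2N-1).$$ If $w_{(k,\ell)}\equiv0$, set all $\lambda_{j,(k,\ell)}=0$ (with arbitrary nodes in $(0,R^2)$). The discrete polyharmonic cubature with parameters $N\ge1$, $M\ge1$, $K\ge0$ is $$I^{\mathrm{poly}}_{(N,M,K)}(f)=\frac{\pi}{M}\sum_{k=0}^{K}\sum_{\ell=1}^{a_k}\sum_{j=1}^{N}\sum_{s=1}^{M}\lambda_{j,(k,\ell)}\,t_{j,(k,\ell)}^{-k/2}\,Y_{(k,\ell)}\!\left(\tfrac{2\pi s}{M}\right) f\!\left(\sqrt{t_{j,(k,\ell)}}\,e^{2\pi i s/M}\right).$$ *)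

(* Defs.v *)
From HB Require Import structures.
From mathcomp Require Import all_boot all_order all_algebra.
From mathcomp Require Import all_classical all_reals all_analysis.

Set Implicit Arguments.
Unset Strict Implicit.
Unset Printing Implicit Defensive.

Import Order.TTheory GRing.Theory Num.Theory.
Import numFieldNormedType.Exports.

Local Open Scope classical_set_scope.
Local Open Scope ring_scope.

Definition polar {R : realType} (r phi : R) : R * R := (r * cos phi, r * sin phi).

Definition open_disc {R : realType} (rad : R) : set (R * R) :=
  [set x | x.1 ^+ 2 + x.2 ^+ 2 < rad ^+ 2].

Definition closed_disc {R : realType} (rad : R) : set (R * R) :=
  [set x | x.1 ^+ 2 + x.2 ^+ 2 <= rad ^+ 2].

Definition ang_dim (k : nat) : nat := if k == 0%N then 1%N else 2%N.

(* Meaningful only for 1 <= l <= ang_dim k. *)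
Definition harmonicY {R : realType} (k l : nat) (phi : R) : R :=
  if k == 0%N then (Num.sqrt (2 * pi))^-1
  else if l == 1%N then (Num.sqrt pi)^-1 * cos (k%:R * phi)
  else (Num.sqrt pi)^-1 * sin (k%:R * phi).

Definition fcoef {R : realType} (w : R * R -> R) (k l : nat) (r : R) : R :=
  \int[lebesgue_measure]_(phi in `[0, 2 * pi])
    (w (polar r phi) * harmonicY k l phi).

Definition pseudo_definite {R : realType} (rad : R) (w : R * R -> R) : Prop :=
  forall k l : nat, (1 <= l <= ang_dim k)%N ->
    (forall r : R, 0 < r < rad -> 0 <= fcoef w k l r) \/
    (forall r : R, 0 < r < rad -> fcoef w k l r <= 0).

(* A weight is a total function of which only the values on the open disc
   matter; radial integrals are therefore taken over open intervals. *)
Record admissible_weight {R : realType} (rad : R) (w : R * R -> R) : Prop := {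
  weight_continuous : forall x : R * R,
    open_disc rad x -> x <> (0, 0) -> {for x, continuous w};
  fcoef_continuous : forall k l : nat, (1 <= l <= ang_dim k)%N ->
    {within `]0, rad[, continuous (fcoef w k l)};
  fcoef_integrable : forall k l : nat, (1 <= l <= ang_dim k)%N ->
    (\int[lebesgue_measure]_(r in `]0%R, rad[) (`|fcoef w k l r| * r)%:E
      < +oo)%E }.

Definition weight_norm {R : realType} (rad : R) (w : R * R -> R) : \bar R :=
  (\sum_(0 <= k <oo) \sum_(1 <= l < (ang_dim k).+1)
     \int[lebesgue_measure]_(r in `]0%R, rad[) (`|fcoef w k l r| * r)%:E)%E.

(* [t] and [lam] are the nodes and weights of the N-point Gauss quadrature for
   rho^(k/2) fcoef(sqrt rho) d rho on [0, rad^2].  When fcoef does not vanish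
   identically, the exactness clause determines them; the common sign of the
   weights is then automatic. *)
Definition gauss_data {R : realType} (rad : R) (w : R * R -> R) (k l N : nat)
    (t lam : 'I_N -> R) : Prop :=
  [/\ forall j, 0 < t j < rad ^+ 2,
      (exists2 r : R, 0 < r < rad & fcoef w k l r != 0) ->
        [/\ forall i j : 'I_N, (i < j)%N -> t i < t j,
            (forall j, 0 < lam j) \/ (forall j, lam j < 0) &
            forall s : nat, (s <= 2 * N - 1)%N ->
              \sum_(j < N) lam j * t j ^+ s =
              \int[lebesgue_measure]_(rho in `]0, rad ^+ 2[)
                (rho ^+ s * (rho `^ (k%:R / 2) * fcoef w k l (Num.sqrt rho)))] &
      (forall r : R, 0 < r < rad -> fcoef w k l r = 0) ->
        forall j, lam j = 0].

(* [t N k l] and [lam N k l] are the N nodes and weights attached to (k, l). *)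
Definition poly_cubature {R : realType}
    (t lam : forall N : nat, nat -> nat -> 'I_N -> R) (N M K : nat)
    (f : R * R -> R) : R :=
  pi / M%:R *
  \sum_(0 <= k < K.+1) \sum_(1 <= l < (ang_dim k).+1)
    \sum_(j < N) \sum_(1 <= s < M.+1)
      lam N k l j * t N k l j `^ (- (k%:R / 2)) *
      harmonicY k l (2 * pi * s%:R / M%:R) *
      f (polar (Num.sqrt (t N k l j)) (2 * pi * s%:R / M%:R)).

Definition weighted_integral {R : realType} (rad : R) (w f : R * R -> R) : R :=
  \int[(@lebesgue_measure R \x @lebesgue_measure R)%E]_(x in open_disc rad)
    (f x * w x).

(* Main.v *)
(* Bounded functionals converge on continuous functions as soon as they do on a
   dense class. The class is spanned by the functions r^(k+2s) Y_(k,l), that is,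
   by all polynomials in x and y. On such a function, discrete orthogonality on
   the M-th roots of unity kills every term (k',l') <> (k,l) with k + k' < M,
   Gauss exactness makes the term (k,l) equal to the integral, and the aliased
   terms are a tail of the series defining the norm of w.
   The uniform bound is sum_j |lam_j| t_j^(-k/2) <= 2 int |w_(k,l)| r dr: the
   Hermite interpolant of rho^(-k/2) at the doubled Gauss nodes lies below it.
   For the limit functional, w is integrable on the disc because the absolute
   sum of the Fourier coefficients of a continuous function on a circle controls
   its L^1 norm, by testing against polynomials close to its sign. *)

Require Import Defs.
From HB Require Import structures.
From mathcomp Require Import all_boot all_order all_algebra.
From mathcomp Require Import all_classical all_reals all_analysis.
From mathcomp Require Import measurable_realfun real_interval.
From mathcomp Require Import zify ring lra.

Import Order.TTheory GRing.Theory Num.Theory.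
Import numFieldNormedType.Exports.

Local Open Scope classical_set_scope.
Local Open Scope ring_scope.

Set Implicit Arguments.
Unset Strict Implicit.
Unset Printing Implicit Defensive.

(** * Discrete orthogonality *)

(** Nothing is assumed about the integrability of [w] itself: it may be singular at the origin, and
    the hypotheses only see its Fourier coefficients one by one. So the target integral must itself
    be shown meaningful and continuous in [f]. This is done circle by circle: pairing [w] with a
    polynomial on a circle equals a finite sum of coefficients of [w] times sampled coefficients of
    the polynomial, so no convergence of Fourier series enters. The constant 2 sqrt(pi) comes from
    there: a sampled coefficient of a function bounded by B is at most 2 pi B / sqrt(pi). The
    cubature is built from the same sampled coefficients, whence the same constant in both bounds.
    Pseudo-definiteness is what lets a minorant of rho^(-k/2) be integrated against a Fourier
    coefficient. That the minorant exists is complete monotonicity, used algebraically through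
    divided differences instead of derivatives. The substitution rho = r^2 produces a factor 2,
    cancelled by the factor pi / M of the cubature, which is half of the natural quadrature weight 2
    pi / M. *)

Lemma cos_nat_2pi (R : realType) (m : nat) (x : R) :
  cos (x + m%:R * (2 * pi)) = cos x /\ sin (x + m%:R * (2 * pi)) = sin x.
Proof.
elim: m => [|m [IHc IHs]]; first by rewrite mul0r addr0.
have -> : x + m.+1%:R * (2 * pi) = (x + m%:R * (2 * pi)) + pi + pi.
  by rewrite -natr1; ring.
by rewrite !cosDpi !sinDpi !opprK IHc IHs.
Qed.

(* With C, S the two sums, shifting the index by one gives
   (C, S) = rotation by h of (C, S), so C = S = 0 unless cos h = 1. *)
Lemma sum_cos_sin_roots (R : realType) (m M : nat) : (0 < m < M)%N ->
  \sum_(1 <= s < M.+1) cos (m%:R * (2 * pi * s%:R / M%:R)) = 0 :> R /\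
  \sum_(1 <= s < M.+1) sin (m%:R * (2 * pi * s%:R / M%:R)) = 0 :> R.
Proof.
move=> /andP[m0 mM].
have M0 : (0 < M)%N by exact: leq_ltn_trans mM.
have MR0 : M%:R != 0 :> R by rewrite pnatr_eq0 -lt0n.
pose h : R := 2 * pi * m%:R / M%:R.
have hE s : m%:R * (2 * pi * s%:R / M%:R) = s%:R * h by rewrite /h; field.
under eq_bigr do rewrite hE.
under [X in _ /\ X = _]eq_bigr do rewrite hE.
have per (g : nat -> R) : g M.+1 = g 1%N ->
    \sum_(1 <= s < M.+1) g s = \sum_(1 <= s < M.+1) g s.+1.
  move=> gM; rewrite big_ltn// [RHS]big_nat_recr//= gM addrC; congr +%R.
  by rewrite big_add1.
have hM : M.+1%:R * h = h + m%:R * (2 * pi).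
  by rewrite -natr1 /h; field.
have [cM sM] := cos_nat_2pi m h.
set C := \sum_(_ <= _ < _) _; set S := \sum_(_ <= _ < _) _.
have eC : C = C * cos h - S * sin h.
  rewrite {1}/C per; last by rewrite hM cM mul1r.
  rewrite mulr_suml mulr_suml -sumrB; apply: eq_bigr => s _.
  by rewrite -natr1 mulrDl mul1r cosD.
have eS : S = S * cos h + C * sin h.
  rewrite {1}/S per; last by rewrite hM sM mul1r.
  rewrite mulr_suml mulr_suml -big_split/=; apply: eq_bigr => s _.
  by rewrite -natr1 mulrDl mul1r sinD.
have sin2 : sin (h / 2) != 0.
  rewrite gt_eqF// sin_gt0_pi//.
  have -> : h / 2 = pi * (m%:R / M%:R) by rewrite /h; field.
  rewrite mulr_gt0 ?pi_gt0 ?divr_gt0 ?ltr0n//=.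
  by rewrite gtr_pMr ?pi_gt0// ltr_pdivrMr ?ltr0n// mul1r ltr_nat.
have c1 : 1 - cos h != 0.
  have -> : h = (h / 2) *+ 2 by rewrite mulr2n; field.
  rewrite cos_mulr2n cos2sin2.
  have -> : 1 - ((1 - sin (h / 2) ^+ 2) *+ 2 - 1) = sin (h / 2) ^+ 2 *+ 2 by ring.
  by rewrite mulrn_eq0/= sqrf_eq0.
have e1 : (1 - cos h) * C = - (S * sin h) by lra.
have e2 : (1 - cos h) * S = C * sin h by lra.
(* This number, equal to (1 - cos h)^2 + (sin h)^2, is the determinant of the identity minus the
   rotation by [h]. *)
have z : 2 * (1 - cos h) != 0 by rewrite mulf_neq0// pnatr_eq0.
have s2 := sin2cos2 h.
split; apply: (mulfI z); rewrite mulr0.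
  have -> : 2 * (1 - cos h) * C =
      (1 - cos h) * ((1 - cos h) * C) + C * (1 - cos h ^+ 2) by ring.
  by rewrite e1 mulrN mulrA e2 -s2; ring.
have -> : 2 * (1 - cos h) * S =
    (1 - cos h) * ((1 - cos h) * S) + S * (1 - cos h ^+ 2) by ring.
by rewrite e2 mulrA [_ * C]e1 -s2; ring.
Qed.

Lemma sum_cos_roots (R : realType) (m M : nat) : (m < M)%N ->
  \sum_(1 <= s < M.+1) cos (m%:R * (2 * pi * s%:R / M%:R)) =
  (if m == 0%N then M%:R else 0) :> R.
Proof.
case: m => [|m] mM; last by case: (@sum_cos_sin_roots R m.+1 M).
under eq_bigr do rewrite mul0r cos0.
by rewrite sumr_const_nat subn1.
Qed.

Lemma sum_sin_roots (R : realType) (m M : nat) : (m < M)%N ->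
  \sum_(1 <= s < M.+1) sin (m%:R * (2 * pi * s%:R / M%:R)) = 0 :> R.
Proof.
case: m => [|m] mM; last by case: (@sum_cos_sin_roots R m.+1 M).
by under eq_bigr do rewrite mul0r sin0; rewrite big1.
Qed.

Lemma harmonicY_norm_le (R : realType) (k l : nat) (phi : R) :
  `|harmonicY k l phi| <= (Num.sqrt pi)^-1.
Proof.
have sp : 0 < Num.sqrt (pi : R) by rewrite sqrtr_gt0 pi_gt0.
rewrite /harmonicY; case: ifPn => _.
  rewrite ger0_norm ?invr_ge0 ?sqrtr_ge0// lef_pV2 ?posrE ?sqrtr_gt0 ?mulr_gt0 ?pi_gt0//.
  by rewrite ler_wsqrtr// ler_peMl ?pi_ge0// ler1n.
by case: ifPn => _; rewrite normrM ger0_norm ?invr_ge0 ?sqrtr_ge0//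
  ler_piMr ?invr_ge0 ?sqrtr_ge0 ?cos_max ?sin_max.
Qed.

(** Product-to-sum formulas turn every product into cosines or sines of frequencies k + k' and |k -
    k'|. Both are below [M], so only frequency 0 survives the summation over the roots of unity. *)
Lemma discrete_orthogonality (R : realType) (k l k' l' M : nat) :
  (1 <= l <= ang_dim k)%N -> (1 <= l' <= ang_dim k')%N -> (k + k' < M)%N ->
  2 * pi / M%:R * \sum_(1 <= s < M.+1)
    harmonicY k l (2 * pi * s%:R / M%:R) * harmonicY k' l' (2 * pi * s%:R / M%:R)
  = ((k == k') && (l == l'))%:R :> R.
Proof.
(* By symmetry, so that the difference frequency is an untruncated [k - k'] in [nat]. *)
wlog : k l k' l' / (k' <= k)%N => [H|k'k] vl vl' kM.
  have [k'k|kk'] := leqP k' k; first exact: H.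
  rewrite eq_sym [l == _]eq_sym -H ?(ltnW kk') 1?addnC//.
  by under eq_bigr do rewrite mulrC.
have M0 : (0 < M)%N by exact: leq_ltn_trans kM.
have MR0 : M%:R != 0 :> R by rewrite pnatr_eq0 -lt0n.
have p0 := @pi_gt0 R; have pn0 : pi != 0 :> R by rewrite gt_eqF.
have spi : (Num.sqrt pi)^-1 * (Num.sqrt pi)^-1 = pi^-1 :> R.
  by rewrite -invfM -expr2 sqr_sqrtr ?pi_ge0.
have dM : (k - k' < M)%N by rewrite (leq_ltn_trans (leq_subr _ _))// (leq_ltn_trans _ kM)// leq_addr.
pose th s : R := 2 * pi * s%:R / M%:R.
have cA s : cos ((k + k')%:R * th s) =
    cos (k%:R * th s) * cos (k'%:R * th s) - sin (k%:R * th s) * sin (k'%:R * th s).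
  by rewrite natrD mulrDl cosD.
have sA s : sin ((k + k')%:R * th s) =
    sin (k%:R * th s) * cos (k'%:R * th s) + cos (k%:R * th s) * sin (k'%:R * th s).
  by rewrite natrD mulrDl sinD.
have cB s : cos ((k - k')%:R * th s) =
    cos (k%:R * th s) * cos (k'%:R * th s) + sin (k%:R * th s) * sin (k'%:R * th s).
  by rewrite natrB// mulrBl cosB.
have sB s : sin ((k - k')%:R * th s) =
    sin (k%:R * th s) * cos (k'%:R * th s) - cos (k%:R * th s) * sin (k'%:R * th s).
  by rewrite natrB// mulrBl sinB.
have CA := sum_cos_roots R kM; have SA := sum_sin_roots R kM.
have CB := sum_cos_roots R dM; have SB := sum_sin_roots R dM.
rewrite -/(th _) in CA SA CB SB.
have eqkk : (k - k' == 0)%N = (k == k') by rewrite subn_eq0 eqn_leq k'k andbT.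
rewrite eqkk in CB.
have half (g : nat -> R) A c : (forall s, c * g s = A s) -> c != 0 ->
    \sum_(1 <= s < M.+1) g s = c^-1 * \sum_(1 <= s < M.+1) A s.
  move=> gA c0; rewrite mulr_sumr; apply: eq_bigr => s _.
  by rewrite -gA mulrA mulVf ?mul1r.
(* The two normalisations pi^(-1/2) cancel the pi of the quadrature weight; the remaining 2 is the
   one of the product-to-sum formulas. *)
have pp (a b c : R) : 2 * (a * b) = c ->
    2 * pi * ((Num.sqrt pi)^-1 * a * ((Num.sqrt pi)^-1 * b)) = c.
  move=> <-; transitivity (2 * pi * ((Num.sqrt pi)^-1 * (Num.sqrt pi)^-1) * (a * b)).
    by ring.
  by rewrite spi; move: (@pi R) pn0 => p pn0; field.
have [k0|k0] := eqVneq k 0%N.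
  have k'0 : k' = 0%N by apply/eqP; rewrite -leqn0 -k0.
  move: vl vl'; rewrite k0 k'0 /ang_dim/=.
  case: l => [|[|]]// _; case: l' => [|[|]]// _ /=.
  rewrite /harmonicY/= sumr_const_nat subn1/=.
  rewrite -mulr_natr -invfM -expr2 sqr_sqrtr ?mulr_ge0 ?pi_ge0//.
  by move: (@pi R) pn0 => p pn0; field; rewrite pn0 MR0.
have kk'0 : (k + k' == 0)%N = false by rewrite addn_eq0 (negbTE k0).
rewrite kk'0/= in CA.
move: vl vl'; rewrite /harmonicY /ang_dim (negbTE k0).
have [k'0|k'0] := eqVneq k' 0%N.
  rewrite k'0 (negbTE k0)/= => _ _; rewrite -mulr_suml.
  rewrite k'0 addn0 in CA SA.
  by case: (l == 1%N); rewrite -mulr_sumr ?CA ?SA mulr0 mul0r mulr0.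
case: l => [|[|[|]]]// _; case: l' => [|[|[|]]]// _ /=; rewrite ?andbT ?andbF.
- rewrite (half _ (fun s => cos ((k + k')%:R * th s) + cos ((k - k')%:R * th s)) (2 * pi)) ?big_split/= ?CA ?CB.
  + case: eqVneq => _; [|by rewrite ?subrr ?addr0 !mulr0].
    by rewrite ?add0r ?subr0/= mulr1n; move: (@pi R) pn0 => p pn0; field; rewrite pn0 MR0.
  + by move=> s; rewrite cA cB -/(th s); apply: pp; ring.
  + by rewrite mulf_neq0// pnatr_eq0.
- rewrite (half _ (fun s => sin ((k + k')%:R * th s) - sin ((k - k')%:R * th s)) (2 * pi)) ?sumrB ?SA ?SB.
  + by rewrite subrr !mulr0.
  + by move=> s; rewrite sA sB -/(th s); apply: pp; ring.
  + by rewrite mulf_neq0// pnatr_eq0.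
- rewrite (half _ (fun s => sin ((k + k')%:R * th s) + sin ((k - k')%:R * th s)) (2 * pi)) ?big_split/= ?SA ?SB.
  + by rewrite addr0 !mulr0.
  + by move=> s; rewrite sA sB -/(th s); apply: pp; ring.
  + by rewrite mulf_neq0// pnatr_eq0.
- rewrite (half _ (fun s => cos ((k - k')%:R * th s) - cos ((k + k')%:R * th s)) (2 * pi)) ?sumrB ?CA ?CB.
  + case: eqVneq => _; [|by rewrite ?subrr ?addr0 !mulr0].
    by rewrite ?add0r ?subr0/= mulr1n; move: (@pi R) pn0 => p pn0; field; rewrite pn0 MR0.
  + by move=> s; rewrite cA cB -/(th s); apply: pp; ring.
  + by rewrite mulf_neq0// pnatr_eq0.
Qed.

(** * Polynomials and Weierstrass approximation *)

Section solid_harmonics.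
Context {R : realType}.
Implicit Types (z : R * R) (F G : R * R -> R).

(* Real and imaginary parts of (x + i y)^k. *)
Fixpoint cpow (k : nat) z : R * R :=
  if k is k'.+1 then
    (z.1 * (cpow k' z).1 - z.2 * (cpow k' z).2,
     z.1 * (cpow k' z).2 + z.2 * (cpow k' z).1)
  else (1, 0).

Definition sqnorm z : R := z.1 ^+ 2 + z.2 ^+ 2.

Lemma cpow_polar k (r phi : R) :
  cpow k (polar r phi) =
  (r ^+ k * cos (k%:R * phi), r ^+ k * sin (k%:R * phi)).
Proof.
elim: k => [|k IH] /=; first by rewrite mul0r cos0 sin0 mulr1 mulr0.
rewrite IH/= -natr1 mulrDl mul1r cosD sinD exprS.
by congr pair; ring.
Qed.

Lemma sqnorm_polar (r phi : R) : sqnorm (polar r phi) = r ^+ 2.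
Proof.
by rewrite /sqnorm/= !exprMn -mulrDr cos2Dsin2 mulr1.
Qed.

(** The polynomial form of r^(k+2s) Y_(k,l). At a Gauss node t = r^2 the cubature divides it by
    t^(k/2), which leaves the moment t^s that Gauss quadrature integrates exactly. *)
Definition solid (k l s : nat) z : R :=
  sqnorm z ^+ s *
  (if k == 0%N then (Num.sqrt (2 * pi))^-1
   else if l == 1%N then (Num.sqrt pi)^-1 * (cpow k z).1
   else (Num.sqrt pi)^-1 * (cpow k z).2).

Lemma solid_polar k l s (r phi : R) :
  solid k l s (polar r phi) = r ^+ (k + 2 * s) * harmonicY k l phi.
Proof.
rewrite /solid /harmonicY sqnorm_polar cpow_polar/= -exprM exprD.
by case: eqVneq => [->|_]; [rewrite expr0 mul1r|case: ifP => _; ring].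
Qed.

(** Only linear operations are built in, so that an induction reduces linear statements to the
    single functions [solid]. Stability under multiplication by a coordinate is proved separately;
    together with the constants it is all that Bernstein polynomials require. *)
Inductive hpoly : (R * R -> R) -> Prop :=
| hpoly_solid k l s : (1 <= l <= ang_dim k)%N -> hpoly (solid k l s)
| hpoly_add F G : hpoly F -> hpoly G -> hpoly (fun z => F z + G z)
| hpoly_scale (c : R) F : hpoly F -> hpoly (fun z => c * F z).

Lemma hpoly_ext F G : F =1 G -> hpoly F -> hpoly G.
Proof. by move=> /funext ->. Qed.

Let sqrtpi_neq0 : Num.sqrt (pi : R) != 0.
Proof. by rewrite sqrtr_eq0 -ltNge pi_gt0. Qed.

Lemma hpoly_cpow1 k s : hpoly (fun z => sqnorm z ^+ s * (cpow k z).1).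
Proof.
case: k => [|k].
  apply: (@hpoly_ext (fun z => Num.sqrt (2 * pi) * solid 0 1 s z)).
    move=> z; rewrite /solid/= mulr1 mulrCA divff ?mulr1// sqrtr_eq0 -ltNge.
    by rewrite mulr_gt0 ?pi_gt0.
  exact/hpoly_scale/hpoly_solid.
apply: (@hpoly_ext (fun z => Num.sqrt pi * solid k.+1 1 s z)).
  by move=> z; rewrite /solid/=; move: (Num.sqrt _) sqrtpi_neq0 => p p0; field.
exact/hpoly_scale/hpoly_solid.
Qed.

Lemma hpoly_cpow2 k s : hpoly (fun z => sqnorm z ^+ s * (cpow k z).2).
Proof.
case: k => [|k].
  apply: (@hpoly_ext (fun z => 0 * solid 0 1 s z)).
    by move=> z; rewrite /= mulr0 mul0r.
  exact/hpoly_scale/hpoly_solid.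
apply: (@hpoly_ext (fun z => Num.sqrt pi * solid k.+1 2 s z)).
  by move=> z; rewrite /solid/=; move: (Num.sqrt _) sqrtpi_neq0 => p p0; field.
exact/hpoly_scale/hpoly_solid.
Qed.

(** Induction on generators freed of the normalising constants and of the cases on [k] and [l], the
    form in which recurrences for powers of x + i y can be used. *)
Lemma hpoly_cpow_ind (P : (R * R -> R) -> Prop) :
  (forall F G, F =1 G -> P F -> P G) ->
  (forall k s, P (fun z => sqnorm z ^+ s * (cpow k z).1)) ->
  (forall k s, P (fun z => sqnorm z ^+ s * (cpow k z).2)) ->
  (forall F G, P F -> P G -> P (fun z => F z + G z)) ->
  (forall c F, P F -> P (fun z => c * F z)) ->
  forall F, hpoly F -> P F.
Proof.
move=> Pext P1 P2 PD PZ F; elim=> {F} [k l s _|F G _ PF _ PG|c F _ PF].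
- rewrite /solid; have [_|k0] := eqVneq k 0%N.
    apply: (Pext (fun z => (Num.sqrt (2 * pi))^-1 * (sqnorm z ^+ s * (cpow 0 z).1))).
      by move=> z /=; ring.
    exact: PZ.
  case: (l == 1%N).
    apply: (Pext (fun z => (Num.sqrt pi)^-1 * (sqnorm z ^+ s * (cpow k z).1))).
      by move=> z /=; ring.
    exact: PZ.
  apply: (Pext (fun z => (Num.sqrt pi)^-1 * (sqnorm z ^+ s * (cpow k z).2))).
    by move=> z /=; ring.
  exact: PZ.
- exact: PD.
- exact: PZ.
Qed.

Lemma hpoly_lin c d F G : hpoly F -> hpoly G -> hpoly (fun z => c * F z + d * G z).
Proof. by move=> hF hG; apply: hpoly_add; exact: hpoly_scale. Qed.

(** With Z = x + i y, the relation 2 x = Z + conj Z gives 2 x Z^(k+1) = Z^(k+2) + |Z|^2 Z^k; take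
    real and imaginary parts. *)
Lemma hpoly_mulx F : hpoly F -> hpoly (fun z => z.1 * F z).
Proof.
move: F; apply: hpoly_cpow_ind => [F G /funext -> //|k s|k s|F G hF hG|c F hF].
- case: k => [|k].
    by apply: hpoly_ext (hpoly_cpow1 1 s) => z /=; ring.
  apply: hpoly_ext (hpoly_lin 2^-1 2^-1 (hpoly_cpow1 k.+2 s) (hpoly_cpow1 k s.+1)).
  by move=> z; rewrite exprS; set Q := sqnorm z ^+ s; rewrite /= /sqnorm; field.
- case: k => [|k].
    by apply: hpoly_ext (hpoly_cpow2 0 s) => z /=; ring.
  apply: hpoly_ext (hpoly_lin 2^-1 2^-1 (hpoly_cpow2 k.+2 s) (hpoly_cpow2 k s.+1)).
  by move=> z; rewrite exprS; set Q := sqnorm z ^+ s; rewrite /= /sqnorm; field.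
- by apply: hpoly_ext (hpoly_add hF hG) => z; ring.
- by apply: hpoly_ext (hpoly_scale c hF) => z; ring.
Qed.

(** Likewise 2 i y Z^(k+1) = Z^(k+2) - |Z|^2 Z^k, where the factor i exchanges real and imaginary
    parts. *)
Lemma hpoly_muly F : hpoly F -> hpoly (fun z => z.2 * F z).
Proof.
move: F; apply: hpoly_cpow_ind => [F G /funext -> //|k s|k s|F G hF hG|c F hF].
- case: k => [|k].
    by apply: hpoly_ext (hpoly_cpow2 1 s) => z /=; ring.
  apply: hpoly_ext (hpoly_lin 2^-1 (- 2^-1) (hpoly_cpow2 k.+2 s) (hpoly_cpow2 k s.+1)).
  by move=> z; rewrite exprS; set Q := sqnorm z ^+ s; rewrite /= /sqnorm; field.
- case: k => [|k].
    by apply: hpoly_ext (hpoly_cpow2 0 s) => z /=; ring.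
  apply: hpoly_ext (hpoly_lin (- 2^-1) 2^-1 (hpoly_cpow1 k.+2 s) (hpoly_cpow1 k s.+1)).
  by move=> z; rewrite exprS; set Q := sqnorm z ^+ s; rewrite /= /sqnorm; field.
- by apply: hpoly_ext (hpoly_add hF hG) => z; ring.
- by apply: hpoly_ext (hpoly_scale c hF) => z; ring.
Qed.

Lemma hpoly_cst (c : R) : hpoly (fun=> c).
Proof.
apply: hpoly_ext (hpoly_scale c (hpoly_cpow1 0 0)) => z /=.
by rewrite expr0 !mulr1.
Qed.

Lemma continuous_sqnorm : continuous sqnorm.
Proof.
by move=> z; apply: cvgD; apply: (@cvgM _ _ _ _ _ _) => //;
  [exact: cvg_fst|exact: cvg_fst|exact: cvg_snd|exact: cvg_snd].
Qed.

Lemma continuous_cpow k :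
  continuous (fun z => (cpow k z).1) /\ continuous (fun z => (cpow k z).2).
Proof.
elim: k => [|k [IH1 IH2]]; first by split=> z; exact: cvg_cst.
split=> z /=.
  by apply: cvgB; apply: cvgM => //; [exact: cvg_fst|exact: IH1|exact: cvg_snd|exact: IH2].
by apply: cvgD; apply: cvgM => //; [exact: cvg_fst|exact: IH2|exact: cvg_snd|exact: IH1].
Qed.

Lemma hpoly_continuous F : hpoly F -> continuous F.
Proof.
move: F; apply: hpoly_cpow_ind => [F G /funext -> //|k s|k s|F G hF hG|c F hF] z.
- apply: cvgM; last exact: (continuous_cpow k).1.
  by apply: (@continuous_comp _ _ _ sqnorm (fun x => x ^+ s)); [exact: continuous_sqnorm|exact: exprn_continuous].
- apply: cvgM; last exact: (continuous_cpow k).2.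
  by apply: (@continuous_comp _ _ _ sqnorm (fun x => x ^+ s)); [exact: continuous_sqnorm|exact: exprn_continuous].
- by apply: cvgD; [exact: hF|exact: hG].
- by apply: cvgM; [exact: cvg_cst|exact: hF].
Qed.

End solid_harmonics.

(** * Bernstein operators *)

Section bernstein.
Context {R : realType}.

(* Expectation of g under the binomial law of parameters n and u. *)
Fixpoint bernstein (n : nat) (u : R) (g : nat -> R) : R :=
  if n is n'.+1 then
    u * bernstein n' u (fun i => g i.+1) + (1 - u) * bernstein n' u g
  else g 0%N.

Lemma bernstein_cst n u c : bernstein n u (fun=> c) = c.
Proof. by elim: n => //= n ->; ring. Qed.

Lemma bernsteinD n u g h :
  bernstein n u (fun i => g i + h i) = bernstein n u g + bernstein n u h.
Proof. by elim: n g h => //= n IH g h; rewrite !IH; ring. Qed.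

Lemma bernsteinZ n u c g : bernstein n u (fun i => c * g i) = c * bernstein n u g.
Proof. by elim: n g => //= n IH g; rewrite !IH; ring. Qed.

(** Variance plus squared bias. The centre [c] is arbitrary because a successful first trial shifts
    it by one in the induction. *)
Lemma bernstein_var n u c :
  bernstein n u (fun i => (i%:R - c) ^+ 2) = n%:R * u * (1 - u) + (n%:R * u - c) ^+ 2.
Proof.
elim: n c => [|n IH] c /=; first by rewrite !mul0r !add0r.
have -> : (fun i : nat => (i.+1%:R - c) ^+ 2) = (fun i => (i%:R - (c - 1)) ^+ 2).
  by apply/funext => i; rewrite -natr1; congr (_ ^+ 2); ring.
by rewrite !IH -natr1; ring.
Qed.

Lemma le_bernstein n u g h : 0 <= u <= 1 ->
  (forall i, (i <= n)%N -> g i <= h i) -> bernstein n u g <= bernstein n u h.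
Proof.
move=> /andP[u0 u1]; elim: n g h => [|n IH] g h gh /=; first exact: gh.
apply: lerD; apply: ler_wpM2l => //; rewrite ?subr_ge0//; apply: IH => i ni.
  exact: gh.
by apply: gh; rewrite (leq_trans ni).
Qed.

(** The values [g i] are themselves functions of the point, so that the operator in one coordinate
    can be nested in the operator in the other. *)
Lemma bernstein_hpoly n (U : R * R -> R) (g : nat -> R * R -> R) :
  (forall F, hpoly F -> hpoly (fun z => U z * F z)) ->
  (forall i, hpoly (g i)) ->
  hpoly (fun z => bernstein n (U z) (fun i => g i z)).
Proof.
move=> hU; elim: n g => [|n IH] g hg /=; first exact: hg.
have h1 := IH _ (fun i => hg i.+1); have h2 := IH _ hg.
apply: hpoly_ext (hpoly_add (hU _ h1) (hpoly_lin 1 (-1) h2 (hU _ h2))) => z.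
by ring.
Qed.

End bernstein.

Lemma compact_continuous_bounded (R : realType) (K : set (R * R)) (f : R * R -> R) :
  compact K -> continuous f -> exists2 B, 0 < B & forall z, K z -> `|f z| <= B.
Proof.
move=> cK cf; have : bounded_set (f @` K).
  by apply: compact_bounded; apply: continuous_compact => //; exact: continuous_subspaceT.
move=> [B [_ fB]]; exists (Num.max (B + 1) 1); first by rewrite lt_max ltr01 orbT.
by move=> z Kz; rewrite le_max (fB (B + 1)) ?ltrDl//; exists z.
Qed.

Lemma closed_disc_box (R : realType) (rad : R) (z : R * R) : 0 <= rad -> closed_disc rad z ->
  (`[- rad, rad]%classic `*` `[- rad, rad]%classic) z.
Proof.
move=> rad0 dz; suff : `|z.1| <= rad /\ `|z.2| <= rad.
  by rewrite !ler_norml => -[z1 z2]; split; rewrite /= in_itv/=.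
rewrite -!(@ler_pXn2r _ 2 _ `|_|) ?nnegrE//.
rewrite !real_normK ?num_real//; move: dz; rewrite /closed_disc/=.
move: (sqr_ge0 z.1) (sqr_ge0 z.2) => ? ?; split; lra.
Qed.

Lemma closed_disc_bounded (R : realType) (rad : R) (f : R * R -> R) : 0 <= rad ->
  continuous f -> exists2 B, 0 < B & forall z, closed_disc rad z -> `|f z| <= B.
Proof.
move=> rad0 cf; have [|B B0 fB] := @compact_continuous_bounded R
    (`[- rad, rad]%classic `*` `[- rad, rad]%classic) f _ cf.
  by apply: compact_setX; exact: segment_compact.
by exists B => // z dz; apply/fB/closed_disc_box.
Qed.

(** A modulus of continuity that is affine in the squared distance: close points are handled by
    continuity, distant ones by making [C] large compared with sup |f|. This form needs only second
    moments when a Bernstein operator is applied to it. *)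
Lemma compact_quadratic_modulus (R : realType) (K : set (R * R)) (f : R * R -> R) :
  compact K -> continuous f -> forall e : R, 0 < e -> exists2 C : R, 0 <= C &
  forall z z', K z -> K z' ->
    `|f z - f z'| <= e + C * ((z.1 - z'.1) ^+ 2 + (z.2 - z'.2) ^+ 2).
Proof.
move=> cK cf e e0.
have [B B0 fB] := compact_continuous_bounded cK cf.
pose P C z := K z -> forall z', K z' ->
  `|f z - f z'| <= e + C * ((z.1 - z'.1) ^+ 2 + (z.2 - z'.2) ^+ 2).
have : \forall C \near +oo, 0 <= C /\ K `<=` P C.
  near=> C; split; first by near: C; exact: nbhs_pinfty_ge.
  near: C; apply: (iffLR (compact_near_coveringP K) cK) => x Kx.
  have e2 : 0 < e / 2 by rewrite divr_gt0.
  have /cvgrPdist_lt/(_ _ e2)/nbhs_ballP[eta /= eta0 feta] := cf x.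
  (* For z within eta / 2 of x, either z' is within eta / 2 of z and both values are near f x, or
     the squared distance is at least (eta / 2)^2 and such a [C] makes the quadratic term exceed 2
     B. *)
  exists (ball x (eta / 2), [set C | 2 * B / (eta / 2) ^+ 2 < C]).
    split; first by apply: (nbhsx_ballx _ _ (divr_gt0 eta0 _)).
    by apply: nbhs_pinfty_gt; rewrite num_real.
  move=> [z C]/= [xz BC] Kz z' Kz'.
  have C0 : 0 <= C.
    by apply/ltW/(le_lt_trans _ BC); rewrite divr_ge0// ?sqr_ge0// mulr_ge0// ltW.
  have fxz : `|f x - f z| < e / 2.
    by apply: feta; apply: le_ball xz; rewrite ler_pdivrMr// ler_pMr// ler1n.
  have q0 : 0 <= (z.1 - z'.1) ^+ 2 + (z.2 - z'.2) ^+ 2 by rewrite addr_ge0// sqr_ge0.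
  have [near_z'|far] := pselect (ball z (eta / 2) z').
    have fxz' : `|f x - f z'| < e / 2.
      by apply: feta; rewrite [eta]splitr; exact: ball_triangle near_z'.
    have -> : f z - f z' = (f x - f z') - (f x - f z) by ring.
    rewrite (le_trans (ler_normB _ _))// (@le_trans _ _ e)//; first by lra.
    by rewrite lerDl mulr_ge0.
  have : (eta / 2) ^+ 2 <= (z.1 - z'.1) ^+ 2 + (z.2 - z'.2) ^+ 2.
    have eta2 : 0 <= eta / 2 by rewrite divr_ge0// ltW.
    rewrite leNgt; apply/negP => lt_eta; apply: far; split; rewrite /ball/=.
      rewrite -(@ltr_pXn2r _ 2)// ?nnegrE// real_normK ?num_real//.
      by rewrite (le_lt_trans _ lt_eta)// lerDl sqr_ge0.
    rewrite -(@ltr_pXn2r _ 2)// ?nnegrE// real_normK ?num_real//.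
    by rewrite (le_lt_trans _ lt_eta)// lerDr sqr_ge0.
  move: BC; set q := _ + _ in q0 *; rewrite ltr_pdivrMr ?exprn_gt0 ?divr_gt0// => BC qeta.
  have := fB _ Kz'; have := fB _ Kz; have := ler_normB (f z) (f z').
  nra.
move=> /filter_ex[C [C0 HC]]; exists C => // z z' Kz; exact: HC.
Unshelve. all: end_near. Qed.

Section weierstrass.
Context {R : realType}.
Variables (rad : R) (rad0 : 0 < rad).

Let den (z : R * R) : R := Num.max rad (Num.sqrt (sqnorm z)).

(** Radial projection onto the closed disc. The maximum in [den] keeps the denominator positive,
    hence the map continuous at the origin too. Composition with it extends a function continuous on
    the closed disc to the whole plane. *)
Definition disc_retract (z : R * R) : R * R :=
  (rad / den z * z.1, rad / den z * z.2).

Let den_gt0 z : 0 < den z. Proof. by rewrite /den lt_max rad0. Qed.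

Lemma sqnorm_ge0 (z : R * R) : 0 <= sqnorm z.
Proof. by rewrite addr_ge0// sqr_ge0. Qed.

Lemma disc_retract_in z : closed_disc rad (disc_retract z).
Proof.
rewrite /closed_disc/= !exprMn -mulrDr -[X in _ * X](sqr_sqrtr (sqnorm_ge0 z)).
rewrite exprVn [X in X <= _]mulrAC ler_pdivrMr ?exprn_gt0//.
rewrite ler_wpM2l ?sqr_ge0// ler_pXn2r ?nnegrE ?sqrtr_ge0 ?(ltW (den_gt0 z))//.
by rewrite /den le_max lexx orbT.
Qed.

Lemma disc_retract_id z : closed_disc rad z -> disc_retract z = z.
Proof.
move=> dz; rewrite /disc_retract.
have -> : den z = rad.
  apply/max_idPl; rewrite -[leRHS]gtr0_norm// -sqrtr_sqr; exact: ler_wsqrtr.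
by rewrite divff ?gt_eqF// !mul1r; case: z {dz}.
Qed.

Lemma disc_retract_continuous : continuous disc_retract.
Proof.
have cden : continuous (fun z => rad / den z).
  move=> z; apply: cvgM; first exact: cvg_cst.
  apply: cvgV; first by rewrite gt_eqF.
  apply: (@continuous_max _ _ (fun=> rad) (fun z => Num.sqrt (sqnorm z))).
    exact: cvg_cst.
  apply: (@continuous_comp _ _ _ sqnorm Num.sqrt); first exact: continuous_sqnorm.
  exact: sqrt_continuous.
have c1 : continuous (fun z => rad / den z * z.1).
  by move=> z; apply: cvgM; [exact: cden|exact: cvg_fst].
have c2 : continuous (fun z => rad / den z * z.2).
  by move=> z; apply: cvgM; [exact: cden|exact: cvg_snd].
by move=> z; exact: (cvg_pair (c1 z) (c2 z)).
Qed.

Lemma continuous_comp_disc_retract (f : R * R -> R) :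
  {within closed_disc rad, continuous f} -> continuous (f \o disc_retract).
Proof.
move=> cf z; apply: (@cvg_trans _ (f @ within (closed_disc rad) (nbhs (disc_retract z)))).
  move=> A; rewrite /within/= !near_simpl/= => HA.
  have := disc_retract_continuous HA; rewrite /= /nbhs/=.
  apply: filterS => z'; apply; exact: disc_retract_in.
have := cf (disc_retract z).
rewrite /continuous_at nbhs_subspace_in//; exact: disc_retract_in.
Qed.

(** Bernstein approximation of the extension of [f] on the square circumscribed to the disc. Half of
    [e] is the constant of the quadratic modulus, the other half pays for [C] times the two
    variances. *)
Lemma weierstrass_disc (f : R * R -> R) (e : R) :
  {within closed_disc rad, continuous f} -> 0 < e ->
  exists2 F, hpoly F & forall z, closed_disc rad z -> `|f z - F z| <= e.
Proof.
move=> cf e0; pose g := f \o disc_retract.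
have cg : continuous g by exact: continuous_comp_disc_retract.
pose K : set (R * R) := `[- rad, rad]%classic `*` `[- rad, rad]%classic.
have cK : compact K by apply: compact_setX; exact: segment_compact.
have e2 : 0 < e / 2 by rewrite divr_gt0.
have [C C0 gC] := compact_quadratic_modulus cK cg e2.
(* In each coordinate the mean squared deviation is 4 rad^2 u (1 - u) / n, at most rad^2 / n; there
   are two coordinates. *)
have [n n0 nC] : exists2 n : nat, (0 < n)%N & C * (2 * rad ^+ 2) / n%:R <= e / 2.
  exists (Num.truncn (C * (2 * rad ^+ 2) / (e / 2))).+1 => //.
  rewrite ler_pdivrMr ?ltr0n// [leRHS]mulrC -ler_pdivrMr//.
  exact/ltW/Num.Theory.truncnS_gt.
have nR : n%:R != 0 :> R by rewrite pnatr_eq0 -lt0n.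
have n0R : 0 < n%:R :> R by rewrite ltr0n.
(* [u] maps [-rad, rad] affinely onto [0, 1], and [pt i] is the preimage of i / n. *)
pose u (x : R) := (x / rad + 1) / 2.
pose pt (i : nat) : R := rad * (2 * (i%:R / n%:R) - 1).
pose F (z : R * R) := bernstein n (u z.1) (fun i =>
  bernstein n (u z.2) (fun j => g (pt i, pt j))).
exists F.
  have hU (pr : R * R -> R) : (forall G, hpoly G -> hpoly (fun z => pr z * G z)) ->
      forall G, hpoly G -> hpoly (fun z => u (pr z) * G z).
    move=> hpr G hG; apply: hpoly_ext (hpoly_lin ((rad)^-1 / 2) 2^-1 (hpr _ hG) hG) => z.
    by rewrite /u; field; rewrite gt_eqF.
  apply: bernstein_hpoly => [|i]; first by apply: hU; exact: hpoly_mulx.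
  apply: bernstein_hpoly => [|j]; first by apply: hU; exact: hpoly_muly.
  exact: hpoly_cst.
move=> z dz.
have -> : f z = g z by rewrite /g /= disc_retract_id.
have Kz : (- rad <= z.1 <= rad) /\ (- rad <= z.2 <= rad).
  by have [] := closed_disc_box (ltW rad0) dz; rewrite /= !in_itv.
have u01 x : - rad <= x <= rad -> 0 <= u x <= 1.
  move=> /andP[x1 x2]; rewrite /u.
  have : -1 <= x / rad <= 1.
    by rewrite ler_pdivlMr// ler_pdivrMr// mulN1r mul1r x1.
  by move=> /andP[? ?]; apply/andP; split; lra.
have Kpt i : (i <= n)%N -> - rad <= pt i <= rad.
  move=> ni; have i1 : 0 <= (i%:R / n%:R : R) <= 1.
    by rewrite divr_ge0//= ler_pdivrMr// mul1r ler_nat.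
  rewrite /pt -ler_norml normrM gtr0_norm// ler_piMr ?(ltW rad0)//.
  by rewrite ler_norml; apply/andP; split; case/andP: i1 => ? ?; lra.
have sq x i : (x - pt i) ^+ 2 = (2 * rad / n%:R) ^+ 2 * (i%:R - n%:R * u x) ^+ 2.
  by rewrite /pt /u; field; rewrite nR gt_eqF.
pose c := (2 * rad / n%:R) ^+ 2.
have var x : - rad <= x <= rad ->
    bernstein n (u x) (fun i => (x - pt i) ^+ 2) <= rad ^+ 2 / n%:R.
  move=> /u01/andP[u0 u1]; under [X in bernstein _ _ X]funext do rewrite sq.
  rewrite bernsteinZ bernstein_var subrr expr0n/= addr0.
  have -> : (2 * rad / n%:R) ^+ 2 * (n%:R * u x * (1 - u x)) =
    rad ^+ 2 / n%:R * (4 * (u x * (1 - u x))) by field.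
  rewrite ler_piMr ?divr_ge0 ?sqr_ge0 ?ler0n//.
  by have := sqr_ge0 (2 * u x - 1); rewrite sqrrB; nra.
have [Kz1 Kz2] := Kz.
have err i j : (i <= n)%N -> (j <= n)%N ->
    `|g z - g (pt i, pt j)| <= e / 2 + C * ((z.1 - pt i) ^+ 2 + (z.2 - pt j) ^+ 2).
  move=> ni nj; apply: gC; split => /=; rewrite in_itv/=; do ?[exact: Kz1|exact: Kz2|exact: Kpt].
have tot : bernstein n (u z.1) (fun i => bernstein n (u z.2) (fun j =>
    e / 2 + C * ((z.1 - pt i) ^+ 2 + (z.2 - pt j) ^+ 2))) <= e.
  have affine (y a b : R) (h : nat -> R) :
      bernstein n y (fun j => a + C * (b + h j)) = a + C * (b + bernstein n y h).
    rewrite (bernsteinD _ _ (fun=> a) (fun j => C * (b + h j))) bernsteinZ.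
    by rewrite (bernsteinD _ _ (fun=> b)) !bernstein_cst.
  have -> : (fun i => bernstein n (u z.2) (fun j =>
        e / 2 + C * ((z.1 - pt i) ^+ 2 + (z.2 - pt j) ^+ 2))) =
      (fun i => e / 2 + C * (bernstein n (u z.2) (fun j => (z.2 - pt j) ^+ 2) +
        (z.1 - pt i) ^+ 2)).
    by apply/funext => i; rewrite affine [X in C * X]addrC.
  rewrite affine [X in C * X]addrC.
  have v1 := var _ Kz1; have v2 := var _ Kz2.
  rewrite [leRHS]splitr lerD2l (le_trans _ nC)// -mulrA ler_wpM2l//.
  by rewrite mulrDl mul1r (_ : _ * _ = rad ^+ 2 / n%:R + rad ^+ 2 / n%:R) ?lerD//; ring.
have up : bernstein n (u z.1) (fun i => bernstein n (u z.2) (fun j => g (pt i, pt j))) <=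
   bernstein n (u z.1) (fun i => bernstein n (u z.2) (fun j => g z + 
    (e / 2 + C * ((z.1 - pt i) ^+ 2 + (z.2 - pt j) ^+ 2)))).
  apply: le_bernstein; first exact: u01.
  move=> i ni; apply: le_bernstein; first exact: u01.
  move=> j nj; have := err i j ni nj; rewrite ler_norml => /andP[? ?]; lra.
have lo : bernstein n (u z.1) (fun i => bernstein n (u z.2) (fun j => g z)) <=
   bernstein n (u z.1) (fun i => bernstein n (u z.2) (fun j => g (pt i, pt j) + 
    (e / 2 + C * ((z.1 - pt i) ^+ 2 + (z.2 - pt j) ^+ 2)))).
  apply: le_bernstein; first exact: u01.
  move=> i ni; apply: le_bernstein; first exact: u01.
  move=> j nj; have := err i j ni nj; rewrite ler_norml => /andP[? ?]; lra.
have dbl (g1 g2 : nat -> nat -> R) :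
   bernstein n (u z.1) (fun i => bernstein n (u z.2) (fun j => g1 i j + g2 i j)) =
   bernstein n (u z.1) (fun i => bernstein n (u z.2) (g1 i)) +
   bernstein n (u z.1) (fun i => bernstein n (u z.2) (g2 i)).
  by rewrite -bernsteinD; congr bernstein; apply/funext => i; rewrite bernsteinD.
have cst : bernstein n (u z.1) (fun i => bernstein n (u z.2) (fun j => g z)) = g z.
  by rewrite bernstein_cst bernstein_cst.
move: up lo tot; rewrite !dbl !cst -!/(F z) => up lo tot.
by rewrite ler_distl lerBlDr (le_trans up) ?(le_trans lo) ?andbT ?lerD2l.
Qed.

End weierstrass.

(** * Bound on the Gauss weights *)

Section gauss_bound.
Context {R : realType}.

(* Functions completely monotone in the variable r^2: they are stable under
   minus the divided difference with respect to r^2. *)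
Inductive sqrt_cm : (R -> R) -> Prop :=
| sqrt_cm_cst (c : R) : 0 <= c -> sqrt_cm (fun=> c)
| sqrt_cm_inv (a : R) : 0 <= a -> sqrt_cm (fun r => (r + a)^-1)
| sqrt_cm_add g h : sqrt_cm g -> sqrt_cm h -> sqrt_cm (fun r => g r + h r)
| sqrt_cm_mul g h : sqrt_cm g -> sqrt_cm h -> sqrt_cm (fun r => g r * h r).

Lemma sqrt_cm_ge0 h r : sqrt_cm h -> 0 < r -> 0 <= h r.
Proof.
move=> + r0; elim=> // [a a0|g {}h _ g0 _ h0|g {}h _ g0 _ h0].
- by rewrite invr_ge0 addr_ge0// ltW.
- exact: addr_ge0.
- exact: mulr_ge0.
Qed.

Lemma sqrt_cm_exprV k : sqrt_cm (fun r => r ^- k).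
Proof.
elim: k => [|k IH].
  by have -> : (fun r : R => r ^- 0) = (fun=> 1);
    [apply/funext => r; rewrite expr0 invr1|apply: sqrt_cm_cst].
have -> : (fun r : R => r ^- k.+1) = (fun r => (r + 0)^-1 * r ^- k).
  by apply/funext => r; rewrite addr0 exprS invfM.
by apply: sqrt_cm_mul => //; exact: sqrt_cm_inv.
Qed.

(** Sums and products follow from the Leibniz rule for divided differences. For (r + a)^-1, dividing
    by r^2 - s^2 instead of r - s creates the new factor (r + s)^-1, which is why the generators
    carry a shift [a]. *)
Lemma sqrt_cm_divdiff h s : sqrt_cm h -> 0 < s -> exists2 h', sqrt_cm h' &
  forall r, 0 < r -> h r = h s - (r ^+ 2 - s ^+ 2) * h' r.
Proof.
move=> + s0; elim=> [c c0|a a0|g {}h hg [g' hg' gE] hh [h' hh' hE]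
  |g {}h hg [g' hg' gE] hh [h' hh' hE]].
- exists (fun=> 0); first exact: sqrt_cm_cst.
  by move=> r _; rewrite mulr0 subr0.
- exists (fun r => (r + a)^-1 * ((s + a)^-1 * (r + s)^-1)).
    apply: sqrt_cm_mul; first exact: sqrt_cm_inv.
    apply: sqrt_cm_mul; last exact/sqrt_cm_inv/ltW.
    by apply: sqrt_cm_cst; rewrite invr_ge0 addr_ge0// ltW.
  move=> r r0.
  have ra : r + a != 0 by rewrite gt_eqF// ltr_wpDr.
  have sa : s + a != 0 by rewrite gt_eqF// ltr_wpDr.
  have rs : r + s != 0 by rewrite gt_eqF// addr_gt0.
  by field; rewrite ra sa rs.
- exists (fun r => g' r + h' r); first exact: sqrt_cm_add.
  by move=> r r0; rewrite gE// hE//; ring.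
- exists (fun r => g' r * h r + g s * h' r).
    apply: sqrt_cm_add; apply: sqrt_cm_mul => //.
    by apply: sqrt_cm_cst; exact: sqrt_cm_ge0 s0.
  move=> r r0; have := gE _ r0; have := hE _ r0.
  move: (r ^+ 2 - s ^+ 2) => D hr gr; rewrite gr [in LHS]mulrBl [X in X - _]mulrC {1}hr.
  by ring.
Qed.

(** Newton's form of the interpolation in the variable r^2, by iterated divided differences. These
    are algebraic and make sense at r = s, so nodes may be repeated: Hermite interpolation comes
    without derivatives. *)
Lemma sqrt_cm_newton h (ss : seq R) : sqrt_cm h -> all (> 0) ss ->
  exists p : {poly R}, exists2 h', sqrt_cm h' & (size p <= size ss)%N /\
    forall r, 0 < r ->
      h r = p.[r ^+ 2] +
        (-1) ^+ size ss * \prod_(s <- ss) (r ^+ 2 - s ^+ 2) * h' r.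
Proof.
elim: ss h => [|s ss IH] h hh.
  move=> _; exists 0, h => //; split; first by rewrite size_poly0.
  by move=> r _; rewrite big_nil horner0 expr0 !mul1r add0r.
move=> /= /andP[s0 ss0].
have [h1 hh1 h1E] := sqrt_cm_divdiff hh s0.
have [p [h' hh' [sp pE]]] := IH _ hh1 ss0.
exists ((h s)%:P - ('X - (s ^+ 2)%:P) * p), h' => //; split.
  rewrite (leq_trans (size_polyD _ _))// geq_max size_polyN size_polyC.
  rewrite (leq_trans (leq_b1 _))//=.
  by rewrite (leq_trans (size_polyMleq _ _))// size_XsubC addSn/= add1n.
move=> r r0; rewrite h1E// pE// big_cons (exprS (-1)) !hornerE/=; ring.
Qed.

(* Interpolating twice at each node leaves a remainder of constant sign. *)
Lemma hermite_minorant k (N : nat) (t : 'I_N -> R) : (forall j, 0 < t j) ->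
  exists p : {poly R}, [/\ (size p <= 2 * N)%N,
    forall j, p.[t j] = Num.sqrt (t j) ^- k &
    forall x, 0 < x -> p.[x] <= Num.sqrt x ^- k].
Proof.
move=> t0; pose ts := [seq Num.sqrt (t j) | j <- enum 'I_N].
have sts : size ts = N by rewrite size_map size_enum_ord.
have [|p [h' hh' [sp pE]]] := sqrt_cm_newton (sqrt_cm_exprV k) (_ : all (> 0) (ts ++ ts)).
  rewrite all_cat; have -> //: all (> 0) ts.
  by apply/allP => _ /mapP[j _ ->]; rewrite sqrtr_gt0.
have E x : 0 < x -> Num.sqrt x ^- k =
    p.[x] + (\prod_(s <- ts) (x - s ^+ 2)) ^+ 2 * h' (Num.sqrt x).
  move=> x0; rewrite pE ?sqrtr_gt0// sqr_sqrtr ?(ltW x0)//; congr (_ + _ * _).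
  by rewrite size_cat sts addnn -mul2n exprM sqrrN expr1n expr1n mul1r big_cat expr2.
exists p; split.
- by rewrite (leq_trans sp)// size_cat sts addnn mul2n.
- move=> j; rewrite E//; suff -> : \prod_(s <- ts) (t j - s ^+ 2) = 0.
    by rewrite expr0n mul0r addr0.
  apply/eqP; rewrite prodf_seq_eq0; apply/hasP; exists (Num.sqrt (t j)).
    by apply: map_f; rewrite mem_enum.
  by rewrite /= sqr_sqrtr ?subrr// ltW.
- move=> x x0; rewrite E// lerDl mulr_ge0 ?sqr_ge0//.
  by apply: sqrt_cm_ge0 => //; rewrite sqrtr_gt0.
Qed.

Lemma powR_half_nat (x : R) k : 0 <= x -> x `^ (k%:R / 2) = Num.sqrt x ^+ k.
Proof.
by move=> x0; rewrite mulrC powRrM powR12_sqrt// powR_mulrn// sqrtr_ge0.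
Qed.

End gauss_bound.

(** * From the minorant to sums of Gauss weights *)

Section gauss_weights.
Context {R : realType}.
Notation mu := (@lebesgue_measure R).
Variables (b : R) (k N : nat) (W : R -> R) (t lam : 'I_N -> R).
Hypothesis b0 : 0 < b.
Hypothesis intW : mu.-integrable `]0, b[ (EFin \o W).
Hypothesis t_in : forall j, 0 < t j < b.
Hypothesis exact_t : forall s, (s <= 2 * N - 1)%N ->
  \sum_(j < N) lam j * t j ^+ s =
  \int[mu]_(rho in `]0, b[) (rho ^+ s * (rho `^ (k%:R / 2) * W rho)).

Let V s (rho : R) := rho ^+ s * (rho `^ (k%:R / 2) * W rho).

Lemma moment_integrable s :
  mu.-integrable `]0, b[ (EFin \o (fun rho => rho ^+ s * (rho `^ (k%:R / 2) * W rho))).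
Proof.
rewrite -/(V s); have -> : EFin \o V s = ((EFin \o (fun rho : R => rho ^+ s * rho `^ (k%:R / 2))%R) \* (EFin \o W))%E.
  by apply/funext => rho; rewrite /V /= -EFinM mulrA.
apply: integrableMr => //.
  apply: measurable_funM; first exact: measurable_funX.
  exact: measurable_funTS.
exists (b ^+ s * b `^ (k%:R / 2)); split; first by rewrite num_real.
move=> M HM rho /=; rewrite in_itv/= => /andP[r0 rb].
apply: le_trans (ltW HM); rewrite ger0_norm ?mulr_ge0 ?exprn_ge0 ?powR_ge0 ?(ltW r0)//.
apply: ler_pM; rewrite ?exprn_ge0 ?powR_ge0 ?(ltW r0)//.
  by rewrite lerXn2r ?nnegrE ?(ltW r0) ?(ltW rb) ?(ltW b0).
by rewrite ge0_ler_powR ?nnegrE ?(ltW r0) ?(ltW rb) ?(ltW b0) ?divr_ge0.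
Qed.

Let intV s : mu.-integrable `]0, b[ (EFin \o V s) := moment_integrable s.

(** Integrability travels with the identity, as additivity of the integral requires it. [n] counts
    coefficients, so the exponents stop at 2N - 1, the degree of exactness. *)
Let exact_poly (p : {poly R}) n : (n <= 2 * N)%N ->
  mu.-integrable `]0, b[ (EFin \o (fun rho => \sum_(i < n) p`_i * V i rho)) /\
  \int[mu]_(rho in `]0, b[) (\sum_(i < n) p`_i * V i rho) =
  \sum_(j < N) lam j * (\sum_(i < n) p`_i * t j ^+ i).
Proof.
elim: n => [_|n IH nN].
  split.
    have -> : EFin \o (fun rho : R => \sum_(i < 0) p`_i * V i rho) = cst 0%E.
      by apply/funext => rho; rewrite /= big_ord0.
    exact: integrable0.
  rewrite big1 => [|j _]; last by rewrite big_ord0 mulr0.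
  under eq_Rintegral do rewrite big_ord0.
  by rewrite Rintegral_cst// mul0r.
have [I1 E1] := IH (ltnW nN).
have I2 : mu.-integrable `]0, b[ (EFin \o (fun rho => p`_n * V n rho)).
  have -> : EFin \o (fun rho => p`_n * V n rho) = (fun x => (p`_n)%:E * (EFin \o V n) x)%E.
    by [].
  exact: integrableZl.
have E : (fun rho => \sum_(i < n.+1) p`_i * V i rho) =
    (fun rho => \sum_(i < n) p`_i * V i rho + p`_n * V n rho).
  by apply/funext => rho; rewrite big_ord_recr.
split.
  rewrite E; have -> : EFin \o (fun rho => \sum_(i < n) p`_i * V i rho + p`_n * V n rho) =
    ((EFin \o (fun rho => \sum_(i < n) p`_i * V i rho)%R) \+ (EFin \o (fun rho => p`_n * V n rho)%R))%E.
    by apply/funext => rho.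
  exact: integrableD.
rewrite E RintegralD// E1 RintegralZl// -exact_t; last first.
  by rewrite -ltnS subn1 prednK// (leq_ltn_trans _ nN).
rewrite mulr_sumr -big_split/=; apply: eq_bigr => j _.
by rewrite big_ord_recr/= mulrDr; congr +%R; ring.
Qed.

(** Let p be the minorant. As p agrees with rho^(-k/2) at the nodes, the sum is that of lam_j
    p(t_j), hence by exactness the integral of p rho^(k/2) W. Since p rho^(k/2) <= 1 and W >= 0,
    this is at most the integral of W. *)
Lemma gauss_weight_bound : (0 < N)%N ->
  (forall rho, 0 < rho < b -> 0 <= W rho) ->
  (forall j, 0 < lam j) \/ (forall j, lam j < 0) ->
  \sum_(j < N) `|lam j| * t j `^ (- (k%:R / 2)) <= \int[mu]_(rho in `]0, b[) W rho.
Proof.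
move=> N0 W0 lamP.
have t0 j : 0 < t j by case/andP: (t_in j).
(* Weights that are all negative are excluded by s = 0: their sum is an integral of a non-negative
   function. *)
have {lamP} lam0 j : 0 < lam j.
  case: lamP => // lamN; exfalso.
  have := exact_t (leq0n _).
  suff : \sum_(j < N) lam j * t j ^+ 0 < 0.
    move=> + E; rewrite E ltNge => /negP; apply; apply: Rintegral_ge0 => rho /=.
    rewrite in_itv/= => /andP[r0 rb].
    by rewrite mul1r mulr_ge0 ?powR_ge0 ?W0// r0.
  rewrite -oppr_gt0 -sumrN; under eq_bigr do rewrite expr0 mulr1.
  rewrite (bigD1 (Ordinal N0))//= ltr_pwDl ?oppr_gt0// sumr_ge0// => i _.
  by rewrite oppr_ge0 ltW.
have [p [sp pt ple]] := hermite_minorant k t0.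
have [I E] := exact_poly p (leqnn _).
have pE (x : R) : \sum_(i < 2 * N) p`_i * x ^+ i = p.[x].
  by rewrite (horner_coef_wide _ sp).
apply: (@le_trans _ _ (\sum_(j < N) lam j * (\sum_(i < 2 * N) p`_i * t j ^+ i))).
  apply: ler_sum => j _.
  by rewrite pE pt gtr0_norm// powRN powR_half_nat// ltW.
rewrite -E; apply: le_Rintegral => //.
move=> rho /=; rewrite in_itv/= => /andP[r0 rb].
have -> : \sum_(i < 2 * N) p`_i * V i rho = p.[rho] * (rho `^ (k%:R / 2) * W rho).
  by rewrite -pE mulr_suml; apply: eq_bigr => i _; rewrite /V; ring.
rewrite powR_half_nat ?(ltW r0)// mulrA ler_piMl ?W0 ?r0//.
have sk : 0 < Num.sqrt rho ^+ k by rewrite exprn_gt0// sqrtr_gt0.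
by rewrite -ler_pdivlMr// mul1r ple.
Qed.

End gauss_weights.

(** * Changes of variable and polar coordinates *)

Section transport.
Local Open Scope ereal_scope.
Context d1 d2 (X : measurableType d1) (Y : measurableType d2) (R : realType).
Variables (phi : X -> Y) (mphi : measurable_fun setT phi).
Variables (mu : {measure set X -> \bar R}) (nu : {measure set Y -> \bar R}).
Variables (h : X -> R) (mh : measurable_fun setT h) (h0 : forall x, (0 <= h x)%R).
Hypothesis nuE : forall A, measurable A ->
  nu A = \int[mu]_(x in phi @^-1` A) (h x)%:E.

Import HBNNSimple.

(** [nuE] says that [nu] is the image under [phi] of [mu] with density [h]. Simple functions and
    monotone convergence carry this from sets to functions. *)
Lemma ge0_integral_transport (g : Y -> \bar R) :
  measurable_fun setT g -> (forall y, 0 <= g y) ->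
  \int[nu]_y g y = \int[mu]_x (g (phi x) * (h x)%:E).
Proof.
move=> mg g0; pose g_ := nnsfun_approx measurableT mg.
have mhE : measurable_fun setT (EFin \o h) by exact/measurable_EFinP.
have mgphi n : measurable_fun setT (fun x => (g_ n (phi x))%:E).
  by apply/measurable_EFinP; apply: measurableT_comp.
have gcv y : (g_ n y)%:E @[n --> \oo] --> g y.
  by apply: cvg_nnsfun_approx.
transitivity (limn (fun n => \int[nu]_y (g_ n y)%:E)).
  rewrite -monotone_convergence//.
  - apply: eq_integral => y _; apply/esym/cvg_lim => //; exact: gcv.
  - by move=> n; exact/measurable_EFinP/measurable_funP.
  - by move=> n y _; rewrite lee_fin.
  - by move=> y _ m n mn; rewrite lee_fin; exact/lefP/nd_nnsfun_approx.
rewrite [X in limn X](_ : _ = (fun n => \int[mu]_x ((g_ n (phi x))%:E * (h x)%:E))).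
  rewrite -monotone_convergence//.
  - apply: eq_integral => x _; apply/cvg_lim => //.
    by apply: cvgeZr => //; exact: gcv.
  - by move=> n; apply: emeasurable_funM.
  - by move=> n x _; rewrite mule_ge0// lee_fin.
  - move=> x _ m n mn; apply: lee_wpmul2r; first by rewrite lee_fin.
    by rewrite lee_fin; exact/lefP/nd_nnsfun_approx.
apply/funext => n.
rewrite integralT_nnsfun sintegralE.
have mpre (A : set Y) : measurable A -> measurable (phi @^-1` A).
  by move=> mA; rewrite -[_ @^-1` _]setTI; exact: mphi.
have mind r : measurable_fun setT (fun x : X => (\1_(g_ n @^-1` [set r]) (phi x) : R)%:E).
  by apply/measurable_EFinP; exact: (measurableT_comp (measurable_indic _)) mphi.
have ind0 r x : 0 <= (\1_(g_ n @^-1` [set r]) (phi x) : R)%:E * (h x)%:E.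
  by rewrite mule_ge0// lee_fin.
transitivity (\sum_(r \in range (g_ n))
    \int[mu]_x (r%:E * (\1_(g_ n @^-1` [set r]) (phi x))%:E * (h x)%:E)).
  apply: eq_fsbigr => r; rewrite inE => -[y _ <-].
  under [RHS]eq_integral do rewrite -muleA.
  rewrite ge0_integralZl_EFin//; last by apply: emeasurable_funM.
  congr (_ * _); rewrite nuE// integral_mkcond; apply: eq_integral => x _.
  rewrite patchE indicE; case: ifPn => [|] xA.
    by rewrite (_ : _ \in _ = true) ?mul1e//.
  by rewrite (_ : _ \in _ = false) ?mul0e//; exact: negbTE.
rewrite -ge0_integral_fsum//.
- apply: eq_integral => x _; rewrite -ge0_mule_fsuml; last first.
    by move=> r; exact: nnfun_muleindic_ge0.
  congr (_ * _); rewrite fimfunE -fsumEFin//.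
- move=> r; apply: emeasurable_funM => //; apply: emeasurable_funM => //.
- by move=> r x _; rewrite mule_ge0 ?lee_fin//; exact: nnfun_muleindic_ge0.
Qed.

End transport.

Section change_of_variable.
Context {R : realType}.
Notation mu := (@lebesgue_measure R).
Variables (D : set R) (Phi Psi dPhi : R -> R).
Hypothesis D_itv : is_interval D.
Hypothesis PsiD : forall y, D (Psi y).
Hypothesis PsiK : forall y, Phi (Psi y) = y.
Hypothesis PhiP : forall x y, D x -> D y -> (x < y -> Phi x < Phi y).
Hypothesis dPhiP : forall x, D x -> is_derive x 1 Phi (dPhi x).
Hypothesis dPhi0 : forall x, D x -> 0 <= dPhi x.
Hypothesis dPhi_cont : forall x, D x -> {for x, continuous dPhi}.

Let mD : measurable D. Proof. exact: is_interval_measurable. Qed.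

(** Both maps are extended by 0 to the whole line; the values of [phi] off [D] are harmless because
    the density [h] vanishes there. *)
Let phi := Phi \_ D.
Let h := dPhi \_ D.

Let PhiK x : D x -> Psi (Phi x) = x.
Proof.
move=> Dx; have [lt|lt|//] := ltgtP (Psi (Phi x)) x.
  by have := PhiP (PsiD _) Dx lt; rewrite PsiK ltxx.
by have := PhiP Dx (PsiD _) lt; rewrite PsiK ltxx.
Qed.

Let Phi_lt x y : D x -> D y -> (Phi x < Phi y) = (x < y).
Proof.
move=> Dx Dy; apply/idP/idP; last exact: PhiP.
by apply: contraTT; rewrite -!leNgt le_eqVlt => /predU1P[->//|/PhiP -/(_ Dy Dx)/ltW].
Qed.

Let mphi : measurable_fun setT phi.
Proof.
apply/(measurable_restrictT Phi mD).
apply: subspace_continuous_measurable_fun => //.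
apply: continuous_in_subspaceT => x /[!inE] Dx.
exact/differentiable_continuous/derivable1_diffP/(@ex_derive _ _ _ _ _ _ _ (dPhiP Dx)).
Qed.

Let mh : measurable_fun setT h.
Proof.
apply/(measurable_restrictT dPhi mD).
apply: subspace_continuous_measurable_fun => //.
by apply: continuous_in_subspaceT => x /[!inE] Dx; exact: dPhi_cont.
Qed.

Let h0 x : 0 <= h x.
Proof. by rewrite /h patchE; case: ifPn => // /[!inE]; exact: dPhi0. Qed.

Let mpre (A : set (measurableTypeR R)) :
  measurable A -> measurable ((phi : measurableTypeR R -> measurableTypeR R) @^-1` A).
Proof. by move=> mA; rewrite -[_ @^-1` _]setTI; exact: mphi. Qed.

Let m (A : set (measurableTypeR R)) : \bar R := (\int[mu]_(x in phi @^-1` A) (h x)%:E)%E.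

Let m_set0 : m set0 = 0%E.
Proof. by rewrite /m preimage_set0 integral_set0. Qed.

Let m_ge0 A : (0 <= m A)%E.
Proof. by apply: integral_ge0 => x _; rewrite lee_fin. Qed.

Let m_sigma : semi_sigma_additive m.
Proof.
move=> F mF tF mUF; rewrite /m preimage_bigcup ge0_integral_bigcup//.
- apply: is_cvg_ereal_nneg_natsum_cond => n _ _; exact: m_ge0.
- by move=> n; exact: mpre.
- exact/measurable_EFinP/measurable_funTS.
- by move=> x _; rewrite lee_fin.
- apply/trivIsetP => i j _ _ ij; rewrite -preimage_setI.
  by move/trivIsetP : tF => ->//; rewrite preimage_set0.
Qed.

Let m_meas : {measure set (measurableTypeR R) -> \bar R} :=
  HB.pack m (isMeasure.Build _ _ _ m m_set0 m_ge0 m_sigma).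

(** By uniqueness of Lebesgue measure it suffices to compare on intervals ]a, b]. Their preimage in
    [D] is ]Psi a, Psi b], over which the derivative of [Phi] integrates to b - a. This needs [Phi]
    to map [D] onto the whole line. *)
Let lebE A : measurable A -> mu A = m A.
Proof.
move=> mA; apply: (@lebesgue_measure_unique R m_meas) => // _ [[a b] _ <-].
rewrite /m_meas /= /m integral_mkcond lebesgue_measure_itv/= lte_fin.
have Psi_lt x y : (Psi x < Psi y) = (x < y) by rewrite -Phi_lt// !PsiK.
have Psi_le x y : (Psi x <= Psi y) = (x <= y) by rewrite !leNgt Psi_lt.
have -> : ((EFin \o h) \_ (phi @^-1` `]a, b]))%E = ((EFin \o dPhi) \_ `]Psi a, Psi b])%E.
  have aux x : D x -> (x \in `]Psi a, Psi b]) = (Phi x \in `]a, b]).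
    by move=> Dx; rewrite !in_itv/= -(Psi_lt a) -(Psi_le _ b) PhiK.
  apply/funext => x; rewrite !patchE.
  have [Dx|nDx] := pselect (D x).
    have -> : (x \in phi @^-1` `]a, b]) = (x \in `]Psi a, Psi b]%classic).
      apply/idP/idP => /set_mem/= H; apply/mem_set => /=.
        by rewrite aux//; move: H; rewrite /phi patchE mem_set.
      by rewrite /phi patchE mem_set// -aux.
    by case: ifPn => // _; rewrite /h/= patchE mem_set.
  have -> : x \in `]Psi a, Psi b]%classic = false.
    apply/negP; rewrite inE/= in_itv/= => /andP[ax xb]; apply: nDx.
    by apply: (D_itv (PsiD a) (PsiD b)); rewrite (ltW ax) xb.
  by case: ifPn => // _; rewrite /h/= patchE memNset.
rewrite -integral_mkcond; case: ifPn => ab; last first.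
  by rewrite set_itv_ge ?integral_set0//= bnd_simp Psi_lt.
have Dab x : Psi a <= x <= Psi b -> D x by exact: (D_itv (PsiD a) (PsiD b)).
have Psiab : Psi a < Psi b by rewrite Psi_lt.
have Phic x : D x -> {for x, continuous Phi}.
  by move=> Dx; exact/differentiable_continuous/derivable1_diffP/(@ex_derive _ _ _ _ _ _ _ (dPhiP Dx)).
rewrite integral_itv_obnd_cbnd; last first.
  apply/measurable_EFinP; apply: subspace_continuous_measurable_fun => //.
  apply: continuous_in_subspaceT => x; rewrite inE/= in_itv/= => /andP[ax xb].
  by apply: dPhi_cont; apply: Dab; rewrite (ltW ax).
rewrite (@continuous_FTC2 _ dPhi Phi)//.
- by rewrite !PsiK.
- apply: continuous_in_subspaceT => x; rewrite inE/= in_itv/= => xab.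
  exact/dPhi_cont/Dab.
- split.
  + move=> x; rewrite in_itv/= => /andP[ax xb].
    have Dx : D x by apply: Dab; rewrite !ltW.
    exact: (@ex_derive _ _ _ _ _ _ _ (dPhiP Dx)).
  + by apply: cvg_at_right_filter; exact: Phic.
  + by apply: cvg_at_left_filter; exact: Phic.
- move=> x; rewrite in_itv/= => /andP[ax xb].
  have Dx : D x by apply: Dab; rewrite !ltW.
  by rewrite derive1E; exact: (@derive_val _ _ _ _ _ _ _ (dPhiP Dx)).
Qed.


Lemma ge0_integral_change_of_variable (g : R -> \bar R) :
  measurable_fun setT g -> (forall y, 0 <= g y)%E ->
  (\int[mu]_y g y = \int[mu]_(x in D) (g (Phi x) * (dPhi x)%:E))%E.
Proof.
move=> mg g0; rewrite (@ge0_integral_transport _ _ (measurableTypeR R) (measurableTypeR R) R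
  phi mphi mu mu h mh h0 lebE g mg g0).
rewrite [RHS]integral_mkcond; apply: eq_integral => x _.
by rewrite /phi /h !patchE; case: ifPn => //; rewrite mule0.
Qed.

End change_of_variable.

Section substitutions.
Context {R : realType}.
Notation mu := (@lebesgue_measure R).
Local Open Scope ereal_scope.

Lemma ge0_integral_scale (c : R) (g : R -> \bar R) : (0 < c)%R ->
  measurable_fun setT g -> (forall y, 0 <= g y) ->
  \int[mu]_y g y = \int[mu]_x (g (c * x)%R * c%:E).
Proof.
move=> c0 mg g0.
apply: (@ge0_integral_change_of_variable R setT ( *%R c) ( *%R c^-1) (fun=> c)) => //.
- by move=> y; rewrite mulrA mulfV ?mul1r// gt_eqF.
- by move=> x y _ _; rewrite ltr_pM2l.
- move=> x _.
  have := @is_deriveZ _ _ _ id c x 1%R 1%R (is_derive_id x 1%R).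
  by rewrite -[X in is_derive _ _ _ X]/(c * 1)%R mulr1.
- by move=> x _; rewrite ltW.
- by move=> x _; exact: cvg_cst.
Qed.

Lemma ge0_integral_tan (g : R -> \bar R) :
  measurable_fun setT g -> (forall y, 0 <= g y) ->
  \int[mu]_y g y =
  \int[mu]_(x in `](- (pi / 2))%R, (pi / 2)%R[) (g (tan x) * ((cos x) ^- 2)%:E).
Proof.
move=> mg g0.
have c0 x : x \in `](- (pi / 2))%R, (pi / 2)%R[ -> (0 < cos x)%R.
  by rewrite in_itv/=; exact: cos_gt0_pihalf.
apply: (@ge0_integral_change_of_variable R _ tan atan (fun x => (cos x) ^- 2)%R) => //.
- exact: interval_is_interval.
- by move=> y /=; rewrite in_itv/= atan_gtNpi2 atan_ltpi2.
- exact: atanK.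
- by move=> x y Dx Dy; rewrite ltr_tan.
- by move=> x Dx; apply: is_derive_tan; rewrite gt_eqF// c0.
- by move=> x Dx; rewrite invr_ge0 sqr_ge0.
- move=> x Dx; apply: cvgV; first by rewrite sqrf_eq0 gt_eqF// c0.
  by apply: (@continuous_comp _ _ _ cos (fun y => y ^+ 2)%R);
    [exact: continuous_cos|exact: exprn_continuous].
Qed.

Lemma ge0_integral_expR (g : R -> \bar R) :
  measurable_fun setT g -> (forall y, 0 <= g y) ->
  \int[mu]_(x in `]0%R, +oo[) g x = \int[mu]_y (g (expR y) * (expR y)%:E).
Proof.
move=> mg g0.
(* The substitution is by [ln], which maps the half-line onto the line; a factor x * x^-1 is
   inserted to exhibit its derivative. *)
transitivity (\int[mu]_(x in `]0%R, +oo[)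
    (g (expR (ln x)) * (expR (ln x))%:E * (x^-1)%:E)).
  apply: eq_integral => x /set_mem/=; rewrite in_itv/= andbT => x0.
  by rewrite lnK ?posrE// -muleA -EFinM mulfV ?mule1// gt_eqF.
apply/esym; apply: (@ge0_integral_change_of_variable R `]0%R, +oo[ (@ln R) expR
  (fun x => x^-1)%R _ _ _ _ _ _ _ (fun y => g (expR y) * (expR y)%:E)).
- exact: interval_is_interval.
- by move=> y; rewrite /= in_itv/= expR_gt0.
- exact: expRK.
- by move=> x y; rewrite /= !in_itv/= !andbT => x0 y0; rewrite ltr_ln ?posrE.
- by move=> x; rewrite /= in_itv/= andbT; exact: is_derive1_ln.
- by move=> x; rewrite /= in_itv/= andbT invr_ge0; exact: ltW.
- move=> x; rewrite /= in_itv/= andbT => x0; apply: cvgV; last exact: cvg_id.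
  by rewrite gt_eqF.
- apply: emeasurable_funM; first by apply: measurableT_comp => //; exact: measurable_expR.
  by apply/measurable_EFinP; exact: measurable_expR.
- by move=> y; rewrite mule_ge0// lee_fin expR_ge0.
Qed.

(* Passing through x = exp u keeps to substitutions onto the whole line. *)
Lemma ge0_integral_sqr (rad : R) (g : R -> \bar R) : (0 < rad)%R ->
  measurable_fun `]0%R, (rad ^+ 2)%R[ g -> (forall y, (0 < y < rad ^+ 2)%R -> 0 <= g y) ->
  \int[mu]_(y in `]0%R, (rad ^+ 2)%R[) g y =
  \int[mu]_(r in `]0%R, rad[) (g (r ^+ 2)%R * (2 * r)%:E).
Proof.
move=> rad0 mg g0; pose G := g \_ `]0%R, (rad ^+ 2)%R[.
have mG : measurable_fun setT G.
  by apply/(measurable_restrictT g (measurable_itv `]0%R, (rad ^+ 2)%R[)); exact: mg.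
have G0 y : 0 <= G y.
  by rewrite /G patchE; case: ifPn => // /set_mem/=; rewrite in_itv/=; exact: g0.
have half (a : R) (F : R -> \bar R) : \int[mu]_(x in `]0%R, +oo[) (F \_ `]0%R, a[) x =
    \int[mu]_(x in `]0%R, a[) F x.
  rewrite -integral_mkcondr; congr (integral _ _ _).
  apply/seteqP; split=> x /=; rewrite !in_itv/= ?andbT; first by case.
  by move=> /andP[x0 xa]; rewrite x0.
rewrite -(half (rad ^+ 2)%R g) -/G [LHS]ge0_integral_expR//.
(* The absolute value keeps [H] non-negative on the whole line, as [ge0_integral_expR] demands. In
   the exponent, squaring becomes scaling by 2. *)
pose H r := (G (r ^+ 2)%R * (2 * `|r|)%:E).
have mH : measurable_fun setT H.
  apply: emeasurable_funM; first by apply: measurableT_comp => //; exact: exprn_measurable.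
  by apply/measurable_EFinP; apply: measurable_funM => //; exact: normr_measurable.
have H0 r : 0 <= H r by rewrite mule_ge0// lee_fin mulr_ge0.
rewrite [LHS](@ge0_integral_scale 2)//; first last.
- by move=> y; rewrite mule_ge0// lee_fin expR_ge0.
- apply: emeasurable_funM; first by apply: measurableT_comp => //; exact: measurable_expR.
  by apply/measurable_EFinP; exact: measurable_expR.
transitivity (\int[mu]_y (H (expR y) * (expR y)%:E)).
  apply: eq_integral => y _; rewrite /H -!muleA -!EFinM.
  rewrite (_ : expR (2 * y) = expR y ^+ 2)%R; last by rewrite mulrC expRM_natr.
  congr (_ * _%:E); rewrite ger0_norm ?expR_ge0//; ring.
rewrite -ge0_integral_expR// -half; apply: eq_integral => r /set_mem/=.
rewrite in_itv/= andbT => r0; rewrite /H /G !patchE !mem_setE !in_itv/= r0 exprn_gt0//=.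
rewrite ltr_pXn2r ?nnegrE ?(ltW r0) ?(ltW rad0)//.
by case: ifP => _; rewrite ?mul0e// ger0_norm// ltW.
Qed.

End substitutions.

Section shift.
Context {R : realType}.
Notation mu := (@lebesgue_measure R).
Local Open Scope ereal_scope.

Lemma ge0_integral_shift (c : R) (g : R -> \bar R) :
  measurable_fun setT g -> (forall y, 0 <= g y) ->
  \int[mu]_y g y = \int[mu]_x g (x + c)%R.
Proof.
move=> mg g0; transitivity (\int[mu]_x (g (x + c)%R * 1%:E)); last first.
  by apply: eq_integral => x _; rewrite mule1.
apply: (@ge0_integral_change_of_variable R setT (fun x => x + c)%R
  (fun x => x - c)%R (fun=> 1%R)) => //.
- by move=> y; rewrite subrK.
- by move=> x y _ _; rewrite ltrD2r.
- move=> x _.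
  have := @is_deriveD _ _ _ id (cst c) x 1%R 1%R 0%R (is_derive_id x 1%R) (is_derive_cst c x 1%R).
  by rewrite addr0.
- by move=> x _; exact: cvg_cst.
Qed.

Lemma ge0_integral_itv_shift (a b c : R) (g : R -> \bar R) :
  measurable_fun setT g -> (forall y, 0 <= g y) ->
  \int[mu]_(y in `](a + c)%R, (b + c)%R[) g y = \int[mu]_(x in `]a, b[) g (x + c)%R.
Proof.
move=> mg g0; rewrite integral_mkcond (ge0_integral_shift c).
- rewrite [RHS]integral_mkcond; apply: eq_integral => x _.
  by rewrite !patchE !mem_setE !in_itv/= !ltrD2r.
- by apply/(measurable_restrictT g (measurable_itv _)); exact: measurable_funTS.
- by move=> y; rewrite patchE; case: ifP.
Qed.

Lemma ge0_integral_itv_split (a b c : R) (g : R -> \bar R) :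
  measurable_fun setT g -> (forall y, 0 <= g y) -> (a < b)%R -> (b < c)%R ->
  \int[mu]_(y in `]a, c[) g y = \int[mu]_(y in `]a, b[) g y + \int[mu]_(y in `]b, c[) g y.
Proof.
move=> mg g0 ab bc.
rewrite (@itv_bndbnd_setU _ _ _ (BRight b))// ?bnd_simp ?ltW// ge0_integral_setU//.
- by rewrite integral_itv_bndo_bndc//; exact: measurable_funTS.
- exact: measurable_funTS.
- rewrite disj_set2E; apply/eqP; rewrite -subset0 => x [] /=.
  by rewrite !in_itv/= => /andP[_ xb] /andP[]; rewrite ltNge xb.
Qed.

Lemma ge0_integral_opp (g : R -> \bar R) :
  measurable_fun setT g -> (forall y, 0 <= g y) ->
  \int[mu]_y g y = \int[mu]_(x in `]0%R, +oo[) (g x + g (- x)%R).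
Proof.
move=> mg g0.
have mgN : measurable_fun setT (g \o -%R) by apply: measurableT_comp => //; exact: oppr_measurable.
rewrite -(setUv (`]0%R, +oo[%classic : set R)) ge0_integral_setU//; first last.
- by rewrite disj_set2E setICr.
- by rewrite setUv.
- exact: measurableC.
rewrite ge0_integralD//; try exact: measurable_funTS.
congr (_ + _); rewrite setCitv/= [X in _ `|` X]set_itv_ge ?bnd_simp// setU0.
rewrite [RHS]integral_itv_obnd_cbnd; last exact: measurable_funTS.
rewrite (@ge0_integration_by_substitution0 R (g \o -%R)) => [|//|r]; last exact: g0.
by apply: eq_integral => x _; rewrite /= opprK.
Qed.

Lemma ge0_integral_oppT (g : R -> \bar R) :
  measurable_fun setT g -> (forall y, 0 <= g y) ->
  \int[mu]_y g (- y)%R = \int[mu]_y g y.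
Proof.
move=> mg g0; rewrite ge0_integral_opp//; last first.
  by apply: measurableT_comp => //; exact: oppr_measurable.
rewrite [RHS]ge0_integral_opp//; apply: eq_integral => x _.
by rewrite opprK addeC.
Qed.

End shift.

Section polar_coordinates.
Context {R : realType}.
Notation mu := (@lebesgue_measure R).
Local Notation RR := (measurableTypeR R * measurableTypeR R)%type.
Local Open Scope ereal_scope.

Let halfpi : set R := `](- (pi / 2))%R, (pi / 2)%R[%classic.
Let pos : set R := `]0%R, +oo[%classic.

Let mpos : measurable (pos : set (measurableTypeR R)).
Proof. exact: measurable_itv. Qed.

Lemma measurable_polar : measurable_fun setT (fun z : RR => polar z.1 z.2 : RR).
Proof.
apply: measurable_fun_pair; apply: measurable_funM => //.
  by apply: measurableT_comp => //; apply: continuous_measurable_fun; exact: continuous_cos.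
by apply: measurableT_comp => //; apply: continuous_measurable_fun; exact: continuous_sin.
Qed.

Definition polar_density (F : RR -> \bar R) (z : RR) : \bar R :=
  F (polar z.1 z.2) * z.1%:E.

Lemma measurable_polar_density F :
  measurable_fun setT F -> measurable_fun setT (polar_density F).
Proof.
move=> mF; apply: emeasurable_funM.
  by apply: measurableT_comp => //; exact: measurable_polar.
exact/measurable_EFinP.
Qed.

(* Substitute y = x u, then u = tan phi, then x = r cos phi. *)
Lemma ge0_integral_half_plane_polar (F : RR -> \bar R) :
  measurable_fun setT F -> (forall z, 0 <= F z) ->
  \int[mu]_(x in pos) \int[mu]_y F (x, y) =
  \int[mu]_(phi in halfpi) \int[mu]_(r in pos) polar_density F (r, phi).
Proof.
move=> mF F0.
have mpair (k : R -> RR) : measurable_fun setT k -> measurable_fun setT (F \o k).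
  by move=> mk; exact: measurableT_comp.
pose K0 (z : RR) := F (z.1, z.1 * z.2)%R * z.1%:E.
(* Cut off at x > 0 so that Tonelli and the substitutions run over whole lines. Once x = r cos phi
   with cos phi > 0, the cut-off reads r > 0. *)
pose K := K0 \_ (pos `*` setT).
have mK0 : measurable_fun setT K0.
  apply: emeasurable_funM; last exact/measurable_EFinP.
  apply: measurableT_comp => //; apply: measurable_fun_pair => //.
  exact: measurable_funM.
have mK : measurable_fun setT K.
  apply/(measurable_restrictT K0 _); last exact: measurable_funTS.
  exact: measurableX.
have KE x u : K (x, u) = if (0 < x)%R then K0 (x, u) else 0.
  rewrite /K patchE; case: ifPn => [/set_mem[/=]|/negP nx].
    by rewrite /pos/= in_itv/= andbT => ->.
  case: ifPn => // x0; exfalso; apply: nx; apply/mem_set; split => //=.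
  by rewrite /pos/= in_itv/= x0.
have K0ge x u : 0 <= K (x, u).
  by rewrite KE; case: ifPn => // x0; rewrite mule_ge0// lee_fin ltW.
have Kge z : 0 <= K z by case: z.
transitivity (\int[mu]_x \int[mu]_u K (x, u)).
  rewrite integral_mkcond; apply: eq_integral => x _.
  rewrite patchE; case: ifPn => [/set_mem|/negP nx].
    rewrite /pos/= in_itv/= andbT => x0.
    rewrite (ge0_integral_scale x0)//; last first.
      by apply: mpair; exact: measurable_fun_pair.
    by apply: eq_integral => u _; rewrite KE x0.
  rewrite integral0_eq// => u _; rewrite KE ifN//; apply/negP => x0; apply: nx.
  by apply/mem_set; rewrite /pos/= in_itv/= x0.
transitivity (\int[mu]_u \int[mu]_x K (x, u)).
  exact: (@fubini_tonelli _ _ _ _ R (@lebesgue_measure R) (@lebesgue_measure R) K mK Kge).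
rewrite ge0_integral_tan//; first last.
- by move=> u; exact: integral_ge0.
- exact: (@measurable_fun_fubini_tonelli_G _ _ _ _ R (@lebesgue_measure R) K mK Kge).
apply: eq_integral => phi /set_mem /=; rewrite in_itv/= => /cos_gt0_pihalf c0.
rewrite (ge0_integral_scale c0)//; last first.
  by apply: (measurableT_comp mK); exact: measurable_fun_pair.
rewrite muleC -ge0_integralZl//; first last.
- by rewrite lee_fin invr_ge0 sqr_ge0.
- by move=> r _; rewrite mule_ge0// lee_fin ltW.
- apply: emeasurable_funM => //; apply: (measurableT_comp mK).
  by apply: measurable_fun_pair => //; exact: measurable_funM.
rewrite [RHS]integral_mkcond; apply: eq_integral => r _.
rewrite patchE KE pmulr_rgt0//.
have -> : (r \in pos) = (0 < r)%R.
  by rewrite mem_setE /pos in_itv/= andbT.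
case: ifPn => [r0|_]; last by rewrite mul0e mule0.
rewrite /K0 /polar_density /polar/= /tan.
rewrite (_ : cos phi * r * (sin phi / cos phi) = r * sin phi)%R; last first.
  by field; rewrite gt_eqF.
(* The three Jacobians, r cos phi, (cos phi)^-2 and cos phi, multiply to r. *)
rewrite [(cos phi * r)%R]mulrC -!muleA -!EFinM muleCA -EFinM; congr (_ * _%:E).
by field; rewrite gt_eqF.
Qed.


Definition polar_radial (F : RR -> \bar R) (phi : R) : \bar R :=
  \int[mu]_(r in pos) polar_density F (r, phi).

Lemma polar_density_pos_ge0 F z : (forall z, 0 <= F z) ->
  0 <= (polar_density F \_ (pos `*` setT)) z.
Proof.
move=> F0; rewrite patchE; case: ifPn => // /set_mem[/=].
rewrite /pos/= in_itv/= andbT => r0 _.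
by rewrite mule_ge0// lee_fin ltW.
Qed.

Lemma measurable_polar_density_pos F : measurable_fun setT F ->
  measurable_fun setT (polar_density F \_ (pos `*` setT)).
Proof.
move=> mF; apply/(measurable_restrictT (polar_density F) _).
  exact: measurableX.
apply: measurable_funTS; exact: measurable_polar_density.
Qed.

Lemma polar_radialE F phi :
  polar_radial F phi = \int[mu]_r (polar_density F \_ (pos `*` setT)) (r, phi).
Proof.
rewrite /polar_radial integral_mkcond; apply: eq_integral => r _.
rewrite !patchE; congr (if _ then _ else _).
by apply/idP/idP => /set_mem H; apply/mem_set; [split|case: H].
Qed.

Lemma measurable_polar_radial F : measurable_fun setT F ->
  (forall z, 0 <= F z) -> measurable_fun setT (polar_radial F).
Proof.
move=> mF F0; rewrite (_ : polar_radial F =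
    fun phi => \int[mu]_r (polar_density F \_ (pos `*` setT)) (r, phi)); last first.
  by apply/funext => phi; exact: polar_radialE.
apply: (@measurable_fun_fubini_tonelli_G _ _ _ _ R (@lebesgue_measure R)).
  exact: measurable_polar_density_pos.
by move=> z; exact: polar_density_pos_ge0.
Qed.

Lemma polar_radial_ge0 F phi : (forall z, 0 <= F z) -> 0 <= polar_radial F phi.
Proof.
move=> F0; apply: integral_ge0 => r; rewrite /pos/= in_itv/= andbT => r0.
by rewrite mule_ge0// lee_fin ltW.
Qed.

(** Reflection through the origin brings the left half-plane to the right one and adds pi to the
    angle. This covers the angles from -pi/2 to 3 pi/2; periodicity then moves the part below 0 up
    by 2 pi. *)
Lemma ge0_integral_polar (F : RR -> \bar R) :
  measurable_fun setT F -> (forall z, 0 <= F z) ->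
  \int[(mu \x mu)%E]_z F z = \int[mu]_(phi in `]0%R, (2 * pi)%R[) polar_radial F phi.
Proof.
move=> mF F0.
pose Fo (z : RR) := F (- z.1, - z.2)%R.
have mFo : measurable_fun setT Fo.
  by apply: (measurableT_comp mF); apply: measurable_fun_pair;
    apply: measurableT_comp => //; exact: oppr_measurable.
rewrite (@fubini_tonelli1 _ _ _ _ R (@lebesgue_measure R) (@lebesgue_measure R))//.
have Fo0 z : 0 <= Fo z by exact: F0.
have ma G : measurable_fun setT G -> (forall z : RR, 0 <= G z) ->
    measurable_fun setT (fubini_F mu G).
  exact: measurable_fun_fubini_tonelli_F.
have a0 G x : (forall z : RR, 0 <= G z) -> 0 <= fubini_F mu G x.
  by move=> G0; apply: integral_ge0 => y _.
rewrite ge0_integral_opp//; [|exact: ma|by move=> x; exact: a0].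
have aN x : fubini_F mu F (- x)%R = fubini_F mu Fo x.
  rewrite /fubini_F -ge0_integral_oppT//.
  by apply: (measurableT_comp mF); exact: measurable_fun_pair.
under eq_integral do rewrite aN.
rewrite ge0_integralD//; first last.
- by apply: measurable_funTS; exact: ma.
- by move=> x _; exact: a0.
- by apply: measurable_funTS; exact: ma.
- by move=> x _; exact: a0.
rewrite ge0_integral_half_plane_polar// ge0_integral_half_plane_polar//.
have mL := measurable_polar_radial mF F0; have L0 phi := polar_radial_ge0 phi F0.
have -> : \int[mu]_(phi in halfpi) \int[mu]_(r in pos) polar_density Fo (r, phi) =
    \int[mu]_(phi in halfpi) polar_radial F (phi + pi)%R.
  apply: eq_integral => phi _; apply: eq_integral => r _.
  by rewrite /polar_density /Fo /polar/= cosDpi sinDpi !mulrN.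
rewrite -[X in X + _]/(\int[mu]_(phi in halfpi) polar_radial F phi).
have p0 := @pi_gt0 R.
have L2pi phi : polar_radial F (phi + 2 * pi)%R = polar_radial F phi.
  apply: eq_integral => r _; rewrite /polar_density /polar/=.
  by have := cos_nat_2pi 1 phi; rewrite mul1r => -[-> ->].
rewrite -ge0_integral_itv_shift//.
rewrite (@ge0_integral_itv_split _ _ 0%R)//; [|lra|lra].
rewrite (_ : \int[mu]_(phi in `](- (pi / 2))%R, 0%R[) polar_radial F phi =
    \int[mu]_(phi in `](- (pi / 2))%R, 0%R[) polar_radial F (phi + 2 * pi)%R); last first.
  by apply: eq_integral => phi _; rewrite L2pi.
rewrite -ge0_integral_itv_shift//.
rewrite [RHS](@ge0_integral_itv_split _ _ (pi / 2)%R)//; [|lra|lra].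
rewrite [X in _ = _ + X](@ge0_integral_itv_split _ _ (pi / 2 + pi)%R)//; [|lra|lra].
rewrite add0r (_ : - (pi / 2) + 2 * pi = pi / 2 + pi)%R; last by lra.
rewrite (_ : - (pi / 2) + pi = pi / 2)%R; last by lra.
by rewrite -addeA [LHS]addeC [RHS]addeA.
Qed.

End polar_coordinates.

Section plane_measurability.
Context {R : realType}.
Local Notation RR := (measurableTypeR R * measurableTypeR R)%type.

(** The plane carries the product sigma-algebra, so openness has to be converted: an open set is the
    union of the countably many boxes with rational centre and radius 1/(n+1) that it contains. *)
Lemma open_measurable_plane (U : set (R * R)) : open U -> measurable (U : set RR).
Proof.
move=> oU.
pose B (i : rat * rat * nat) : set RR :=
  ball (ratr i.1.1 : R) i.2.+1%:R^-1 `*` ball (ratr i.1.2 : R) i.2.+1%:R^-1.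
pose C i := if pselect (B i `<=` U) then B i else set0.
have -> : U = \bigcup_i C i.
  apply/seteqP; split => [x Ux|x [i _]]; last first.
    by rewrite /C; case: pselect => // BU /BU.
  have /nbhs_ballP[e /= e0 eU] := open_nbhs_nbhs (conj oU Ux).
  have [n en] : exists n, n.+1%:R^-1 < e / 2.
    have /ltr_add_invr[n] : 0 < e / 2 by rewrite divr_gt0.
    by rewrite add0r => ?; exists n.
  have n0 : 0 < n.+1%:R^-1 :> R by rewrite invr_gt0.
  have rat_near (y : R) : exists q : rat, `|y - ratr q| < n.+1%:R^-1.
    have yn : y - n.+1%:R^-1 < y + n.+1%:R^-1.
      by rewrite ltrBlDr -addrA ltrDl addr_gt0.
    have [q] := rat_in_itvoo yn.
    rewrite in_itv/= => /andP[q1 q2]; exists q.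
    by rewrite ltr_distlC q1 q2.
  have [q1 xq1] := rat_near x.1; have [q2 xq2] := rat_near x.2.
  exists (q1, q2, n) => //; rewrite /C; case: pselect => [BU|nBU].
    by split; apply: ball_sym.
  have tri (y q z : R) : `|y - q| < n.+1%:R^-1 -> `|q - z| < n.+1%:R^-1 -> `|y - z| < e.
    move=> yq qz; rewrite (le_lt_trans (ler_distD q y z))// [e]splitr.
    by rewrite ltrD// (lt_trans _ en).
  by exfalso; apply: nBU => y [/= y1 y2]; apply: eU; split => /=;
    [exact: tri y1|exact: tri y2].
apply: countable_bigcupT_measurable => // i; rewrite /C; case: pselect => ?; last exact: measurable0.
by apply: measurableX; exact: measurable_ball.
Qed.

Lemma open_continuous_measurable_plane (D : set (R * R)) (f : R * R -> R) :
  open D -> {in D, continuous f} -> measurable_fun (D : set RR) f.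
Proof.
move=> oD cf mD; apply: (measurability _ (RGenOpens.measurableE R)) => //.
move=> _ [_ [a [b ->] <-]]; apply: open_measurable_plane.
rewrite openE => x [Dx fx]; rewrite /interior.
apply: filterI; first exact: open_nbhs_nbhs.
have := cf x (mem_set Dx); apply.
exact: (open_nbhs_nbhs (conj (interval_open _ _) fx)).
Qed.

End plane_measurability.

(** * Polar coordinates for signed integrands *)

Section polar_product.
Context {R : realType}.
Notation mu := (@lebesgue_measure R).
Local Notation RR := (measurableTypeR R * measurableTypeR R)%type.
Local Open Scope ereal_scope.

Definition polar_domain : set RR :=
  `]0%R, +oo[%classic `*` `]0%R, (2 * pi)%R[%classic.

Definition polar_pullback (F : RR -> \bar R) : RR -> \bar R :=
  polar_density F \_ polar_domain.

Lemma measurable_polar_domain : measurable polar_domain.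
Proof. by apply: measurableX; exact: measurable_itv. Qed.

Lemma measurable_polar_pullback F :
  measurable_fun setT F -> measurable_fun setT (polar_pullback F).
Proof.
move=> mF; apply/(measurable_restrictT (polar_density F) measurable_polar_domain).
apply: measurable_funTS; exact: measurable_polar_density.
Qed.

Lemma polar_pullback_ge0 F z : (forall z, 0 <= F z) -> 0 <= polar_pullback F z.
Proof.
move=> F0; rewrite /polar_pullback patchE; case: ifPn => // /set_mem[/=].
rewrite in_itv/= andbT => r0 _.
by rewrite mule_ge0// lee_fin ltW.
Qed.

Lemma ge0_integral_polar_pullback (F : RR -> \bar R) :
  measurable_fun setT F -> (forall z, 0 <= F z) ->
  \int[(mu \x mu)%E]_z F z = \int[(mu \x mu)%E]_z polar_pullback F z.
Proof.
move=> mF F0; rewrite ge0_integral_polar//.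
rewrite (@fubini_tonelli2 _ _ _ _ R (@lebesgue_measure R) (@lebesgue_measure R))//; first last.
- by move=> z; exact: polar_pullback_ge0.
- exact: measurable_polar_pullback.
rewrite integral_mkcond; apply: eq_integral => phi _.
rewrite patchE; case: ifPn => [phi_in|phi_out].
  rewrite /polar_radial integral_mkcond; apply: eq_integral => r _.
  rewrite /polar_pullback !patchE; congr (if _ then _ else _).
  apply/idP/idP => /set_mem H; apply/mem_set; last by case: H.
  by split => //; exact: set_mem.
rewrite /fubini_G integral0_eq// => r _; rewrite /polar_pullback patchE ifN//.
by apply/negP => /set_mem[/= _ H]; move/negP: phi_out; apply; exact/mem_set.
Qed.

(** Positive and negative parts commute with the pullback because r > 0 on the domain. The angle is
    integrated first, the order in which Fourier coefficients appear. *)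
Lemma integral_polar_pullback (F : RR -> \bar R) :
  (mu \x mu)%E.-integrable setT F ->
  \int[(mu \x mu)%E]_z F z = \int[mu]_r \int[mu]_phi polar_pullback F (r, phi).
Proof.
move=> iF; have mF := measurable_int _ iF.
have mP := measurable_polar_pullback mF.
have pos z : polar_domain z -> (0 < z.1)%R by case=> /=; rewrite in_itv/= andbT.
have posE G : (polar_pullback G)^\+ = polar_pullback G^\+.
  apply/funext => z; rewrite /polar_pullback funeposE !patchE.
  case: ifPn => [/set_mem/pos z0|_]; last by rewrite maxxx.
  by rewrite /polar_density funeposE maxe_pMl ?mul0e ?lee_fin ?ltW.
have negE G : (polar_pullback G)^\- = polar_pullback G^\-.
  apply/funext => z; rewrite /polar_pullback funenegE !patchE.
  case: ifPn => [/set_mem/pos z0|_]; last by rewrite oppe0 maxxx.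
  by rewrite /polar_density funenegE maxe_pMl ?mul0e ?lee_fin ?ltW// mulNe.
have iP : (mu \x mu)%E.-integrable setT (polar_pullback F).
  apply/integrableP; split => //.
  have -> : \int[(mu \x mu)%E]_z `|polar_pullback F z| =
      \int[(mu \x mu)%E]_z polar_pullback (abse \o F) z.
    apply: eq_integral => z _; rewrite /polar_pullback !patchE.
    case: ifPn => [/set_mem/pos z0|_]; last by rewrite abse0.
    by rewrite /polar_density abseM/= gtr0_norm.
  rewrite -ge0_integral_polar_pullback//; [by case/integrableP: iF| |].
    exact: measurableT_comp.
  by move=> z; exact: abse_ge0.
rewrite -[RHS]/(\int[mu]_r fubini_F mu (polar_pullback F) r).
rewrite (@integral12_prod_meas1 _ _ _ _ R (@lebesgue_measure R) (@lebesgue_measure R))//.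
rewrite [LHS]integralE [RHS]integralE posE negE.
rewrite -!ge0_integral_polar_pullback//; [exact: measurable_funeneg|exact: measurable_funepos].
Qed.

End polar_product.

(** * Integrability of the weight on the disc *)

Section circle.
Context {R : realType}.
Notation mu := (@lebesgue_measure R).
Variables (rad : R) (w : R * R -> R).
Hypothesis w_cont : forall x : R * R,
  open_disc rad x -> x <> (0, 0) -> {for x, continuous w}.

Lemma continuous_polar (r : R) : continuous (fun phi => polar r phi).
Proof.
have c1 : continuous (fun phi : R => r * cos phi).
  by move=> z; apply: cvgM; [exact: cvg_cst|exact: continuous_cos].
have c2 : continuous (fun phi : R => r * sin phi).
  by move=> z; apply: cvgM; [exact: cvg_cst|exact: continuous_sin].
by move=> z; exact: (cvg_pair (c1 z) (c2 z)).
Qed.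

Lemma weight_continuous_at z : 0 < sqnorm z < rad ^+ 2 -> {for z, continuous w}.
Proof.
move=> /andP[z0 zr]; apply: w_cont => // zE.
by move: z0; rewrite zE /sqnorm/= expr0n/= addr0 ltxx.
Qed.

Lemma weight_polar_continuous (r : R) : 0 < r < rad ->
  continuous (fun phi => w (polar r phi)).
Proof.
move=> /andP[r0 rr] phi.
apply: (@continuous_comp _ _ _ (polar r) w); first exact: continuous_polar.
apply: weight_continuous_at; rewrite sqnorm_polar exprn_gt0//=.
by rewrite ltr_pXn2r ?nnegrE ?(ltW r0) ?(ltW (lt_trans r0 rr)).
Qed.

Lemma harmonicY_continuous k l : continuous (harmonicY k l : R -> R).
Proof.
have ck : continuous (fun phi : R => k%:R * phi).
  by move=> x; apply: cvgM; [exact: cvg_cst|exact: cvg_id].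
have cc : continuous (fun phi : R => cos (k%:R * phi)).
  by move=> phi; apply: (@continuous_comp _ _ _ (fun x : R => k%:R * x) cos);
    [exact: ck|exact: continuous_cos].
have cs : continuous (fun phi : R => sin (k%:R * phi)).
  by move=> phi; apply: (@continuous_comp _ _ _ (fun x : R => k%:R * x) sin);
    [exact: ck|exact: continuous_sin].
rewrite /harmonicY => phi; case: (k == 0%N); first exact: cvg_cst.
by case: (l == 1%N); apply: cvgM; [exact: cvg_cst|exact: cc|exact: cvg_cst|exact: cs].
Qed.

Lemma continuous_itv_integrable (a b : R) (g : R -> R) : continuous g ->
  mu.-integrable `[a, b] (EFin \o g).
Proof.
move=> cg; apply: continuous_compact_integrable; first exact: segment_compact.
exact: continuous_subspaceT.
Qed.

Lemma hpoly_polar_continuous F (r : R) : hpoly F -> continuous (fun phi => F (polar r phi)).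
Proof.
move=> hF phi; apply: (@continuous_comp _ _ _ (polar r) F); first exact: continuous_polar.
exact: hpoly_continuous.
Qed.

Variable r : R.
Hypothesis r_in : 0 < r < rad.

Let W phi := w (polar r phi).
Let cW : continuous W. Proof. exact: weight_polar_continuous. Qed.

Let cWF F : hpoly F -> continuous (fun phi => W phi * F (polar r phi)).
Proof.
by move=> hF phi; apply: cvgM; [exact: cW|exact: hpoly_polar_continuous].
Qed.

(** The M-point trapezoidal value of the Fourier coefficient of [g]; both the pairing on a circle
    and the cubature are expressed by it. *)
Definition sample_sum (M : nat) (g : R -> R) (k l : nat) : R :=
  2 * pi / M%:R * \sum_(1 <= s < M.+1)
    g (2 * pi * s%:R / M%:R) * harmonicY k l (2 * pi * s%:R / M%:R).

(** The quadrature weights add up to 2 pi and |Y| <= pi^(-1/2), whence 2 sqrt(pi). *)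
Lemma sample_sum_bound M g k l B : 0 <= B -> (forall phi, `|g phi| <= B) ->
  `|sample_sum M g k l| <= 2 * Num.sqrt pi * B.
Proof.
move=> B0 gB; have p0 := @pi_gt0 R.
have sp0 : Num.sqrt pi != 0 :> R by rewrite gt_eqF ?sqrtr_gt0.
have [->|M0] := posnP M.
  by rewrite /sample_sum invr0 mulr0 mul0r normr0 !mulr_ge0// sqrtr_ge0.
have MR : M%:R != 0 :> R by rewrite pnatr_eq0 -lt0n.
rewrite /sample_sum normrM ger0_norm ?divr_ge0 ?mulr_ge0 ?ler0n ?(ltW p0)//.
apply: (@le_trans _ _ (2 * pi / M%:R * \sum_(1 <= s < M.+1) (B * (Num.sqrt pi)^-1))).
  rewrite ler_wpM2l ?divr_ge0 ?mulr_ge0 ?ler0n ?(ltW p0)//.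
  rewrite (le_trans (ler_norm_sum _ _ _))//; apply: ler_sum => s _.
  by rewrite normrM ler_pM// harmonicY_norm_le.
rewrite sumr_const_nat subn1/= -mulr_natr.
rewrite -{1}(sqr_sqrtr (ltW p0)).
by rewrite le_eqVlt; apply/orP; left; apply/eqP; field; rewrite sp0 MR.
Qed.

(** A Parseval identity with the coefficients of [F] replaced by sampled ones. With [n0] at least
    the angular degree of [F], taking K >= n0 includes all its frequencies and M > K + n0 excludes
    aliasing, so the sum is finite and exact. *)
Lemma fourier_sample F : hpoly F -> exists n0 : nat, forall K M : nat,
  (n0 <= K)%N -> (K + n0 < M)%N ->
  \int[mu]_(phi in `[0, 2 * pi]) (W phi * F (polar r phi)) =
  \sum_(0 <= k < K.+1) \sum_(1 <= l < (ang_dim k).+1)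
    fcoef w k l r * sample_sum M (fun phi => F (polar r phi)) k l.
Proof.
elim=> {F} [k' l' s vl'|F G hF [n1 H1] hG [n2 H2]|c F hF [n0 H0]].
- exists k' => K M nK nM.
  under eq_Rintegral do rewrite solid_polar mulrCA.
  rewrite RintegralZl//; last first.
    apply: continuous_itv_integrable => phi.
    by apply: cvgM; [exact: cW|exact: harmonicY_continuous].
  rewrite -/(fcoef w k' l' r).
  have term k l : (k < K.+1)%N -> (1 <= l <= ang_dim k)%N ->
      sample_sum M (fun phi => solid k' l' s (polar r phi)) k l =
      r ^+ (k' + 2 * s) * ((k == k') && (l == l'))%:R.
    move=> kK vl; rewrite -(@discrete_orthogonality R k l k' l' M)//; last first.
      by rewrite (leq_ltn_trans _ nM)// leq_add2r.
    rewrite /sample_sum mulrCA; congr (_ * _); rewrite mulr_sumr.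
    by apply: eq_bigr => i _; rewrite solid_polar; ring.
  rewrite big_mkord (bigD1 (Ordinal (nK : (k' < K.+1)%N)))//= [X in _ = _ + X]big1 ?addr0; last first.
    move=> i ik'; rewrite big_nat big1// => l vl; rewrite term//.
    by rewrite (_ : (i == k' :> nat) = false) ?mulr0//; exact/negbTE.
  rewrite (bigD1_seq l') ?iota_uniq ?mem_index_iota//= term// !eqxx mulr1.
  rewrite big1_seq ?addr0 1?mulrC// => l /andP[ll']; rewrite mem_index_iota => vl.
  by rewrite term// (negbTE ll') andbF !mulr0.
- exists (maxn n1 n2) => K M; rewrite geq_max => /andP[n1K n2K] nM.
  under eq_Rintegral do rewrite mulrDr.
  rewrite RintegralD//; try (apply: continuous_itv_integrable; exact: cWF).
  rewrite (H1 K M)//; last by rewrite (leq_ltn_trans _ nM)// leq_add2l leq_maxl.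
  rewrite (H2 K M)//; last by rewrite (leq_ltn_trans _ nM)// leq_add2l leq_maxr.
  rewrite -big_split/=; apply: eq_bigr => k _; rewrite -big_split/=.
  apply: eq_bigr => l _; rewrite -mulrDr /sample_sum -mulrDr -big_split/=.
  by under [in RHS]eq_bigr do rewrite mulrDl.
- exists n0 => K M nK nM.
  under eq_Rintegral do rewrite mulrCA.
  rewrite RintegralZl//; last by apply: continuous_itv_integrable; exact: cWF.
  rewrite (H0 K M)// mulr_sumr; apply: eq_bigr => k _; rewrite mulr_sumr.
  apply: eq_bigr => l _; rewrite mulrCA; congr (_ * _).
  rewrite /sample_sum mulrCA; congr (_ * _); rewrite mulr_sumr.
  by apply: eq_bigr => i _; rewrite mulrA.
Qed.

(** The bound depends on [F] only through its supremum on the circle and not on its degree, so [F]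
    may approximate any continuous test function. *)
Lemma fourier_duality F B S : hpoly F -> 0 <= B ->
  (forall phi, `|F (polar r phi)| <= B) ->
  (forall K, \sum_(0 <= k < K.+1) \sum_(1 <= l < (ang_dim k).+1) `|fcoef w k l r| <= S) ->
  `|\int[mu]_(phi in `[0, 2 * pi]) (W phi * F (polar r phi))| <= 2 * Num.sqrt pi * B * S.
Proof.
move=> hF B0 FB SK; have [n0 H] := fourier_sample hF.
(* The smallest [K] and [M] that [fourier_sample] admits. *)
rewrite (H n0 (n0 + n0).+1)//.
have c0 : 0 <= 2 * Num.sqrt pi * B by rewrite !mulr_ge0// sqrtr_ge0.
apply: le_trans (ler_wpM2l c0 (SK n0)).
rewrite mulr_sumr (le_trans (ler_norm_sum _ _ _))//; apply: ler_sum => k _.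
rewrite mulr_sumr (le_trans (ler_norm_sum _ _ _))//; apply: ler_sum => l _.
by rewrite normrM mulrC ler_wpM2r// sample_sum_bound.
Qed.

End circle.

(** * From Fourier coefficients to the L1 norm on a circle *)

Section circle_L1.
Context {R : realType}.
Notation mu := (@lebesgue_measure R).
Variables (rad : R) (w : R * R -> R).
Hypothesis w_cont : forall x : R * R,
  open_disc rad x -> x <> (0, 0) -> {for x, continuous w}.
Variable r : R.
Hypothesis r_in : 0 < r < rad.

Let W phi := w (polar r phi).
Let cW : continuous W. Proof. exact: (weight_polar_continuous w_cont r_in). Qed.

(* A continuous stand-in, on the whole plane, for the sign of w on the circle. *)
Lemma approximate_sign (eta : R) : 0 < eta -> exists h : R * R -> R,
  [/\ continuous h, forall z, `|h z| <= 1 &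
      forall phi, `|W phi| - eta <= W phi * h (polar r phi)].
Proof.
move=> eta0; have /andP[r0 rr] := r_in.
have rad0 : 0 < rad := lt_trans r0 rr.
(* The annulus of points with |sqnorm z - r^2| < d misses the origin and the boundary, where [w]
   need not be continuous. The cut-off [chi] lives there and equals 1 on the circle. *)
pose d := Num.min (r ^+ 2) (rad ^+ 2 - r ^+ 2).
have d0 : 0 < d.
  by rewrite lt_min exprn_gt0//= subr_gt0 ltr_pXn2r ?nnegrE ?(ltW r0) ?(ltW rad0).
pose chi (z : R * R) := Num.max 0 (1 - `|sqnorm z - r ^+ 2| / d).
have chi01 z : 0 <= chi z <= 1.
  rewrite /chi le_max lexx/= ge_max ler01/=.
  by rewrite gerBl divr_ge0// ltW.
have cchi : continuous chi.
  move=> z; apply: (@continuous_max _ _ (fun=> 0) (fun z => 1 - `|sqnorm z - r ^+ 2| / d)).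
    exact: cvg_cst.
  apply: cvgB; first exact: cvg_cst.
  apply: cvgM; last exact: cvg_cst.
  apply: cvg_norm; apply: cvgB; last exact: cvg_cst.
  exact: continuous_sqnorm.
have m0 z : 0 < Num.max `|w z| eta by rewrite lt_max eta0 orbT.
(* The sign of [w] where |w| >= eta. Elsewhere |w| - eta is negative while w G is not, so the
   required inequality still holds. *)
pose G z := w z / Num.max `|w z| eta.
have G1 z : `|G z| <= 1.
  rewrite /G normrM normfV [`|Num.max _ _|]gtr0_norm// ler_pdivrMr// mul1r.
  by rewrite le_max lexx.
pose h z := chi z * G z.
exists h; split.
- move=> z; have /andP[chi0 _] := chi01 z.
  move: chi0; rewrite le_eqVlt => /predU1P[chi0|chi0].
    have hz : h z = 0 by rewrite /h -chi0 mul0r.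
    rewrite /continuous_at hz; apply/cvgrPdist_lt => e e0.
    have := cchi z; rewrite /continuous_at -chi0 => /cvgrPdist_lt/(_ e e0).
    apply: filterS => z'; rewrite !sub0r !normrN /h normrM => chie.
    by rewrite (le_lt_trans _ chie)// ler_piMr.
  have wz : {for z, continuous w}.
    apply: (weight_continuous_at w_cont).
    move: chi0; rewrite /chi lt_max ltxx/= subr_gt0 ltr_pdivrMr// mul1r.
    rewrite /d lt_min !ltr_norml => /andP[/andP[? ?] /andP[? ?]].
    by apply/andP; split; lra.
  apply: cvgM; first exact: cchi.
  apply: cvgM; first exact: wz.
  apply: cvgV; first by rewrite gt_eqF.
  apply: (@continuous_max _ _ (fun z => `|w z|) (fun=> eta)); last exact: cvg_cst.
  exact: cvg_norm.
- move=> z; have /andP[c0 c1] := chi01 z.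
  by rewrite /h normrM mulr_ile1// ger0_norm.
- move=> phi; have -> : h (polar r phi) = G (polar r phi).
    by rewrite /h /chi sqnorm_polar subrr normr0 mul0r subr0 (max_idPr _) ?mul1r.
  rewrite /G -/(W phi) mulrA -expr2 -(real_normK (num_real (W phi))).
  have [le|lt] := leP eta `|W phi|.
    have W0 : 0 < `|W phi| := lt_le_trans eta0 le.
    by rewrite expr2 mulfK ?gt_eqF// gerBl ltW.
  rewrite (@le_trans _ _ 0)//; first by rewrite subr_le0 ltW.
  by rewrite divr_ge0// ?sqr_ge0// ltW.
Qed.

(** Replacing the sign by a polynomial costs a multiple of the L1 norm [A] itself. This is absorbed
    because [A] is finite, by continuity on the circle, and the multiple is arbitrarily small. *)
Lemma circle_L1_bound S :
  (forall K, \sum_(0 <= k < K.+1) \sum_(1 <= l < (ang_dim k).+1) `|fcoef w k l r| <= S) ->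
  \int[mu]_(phi in `[0, 2 * pi]) `|W phi| <= 2 * Num.sqrt pi * S.
Proof.
move=> SK; have /andP[r0 rr] := r_in; have p0 := @pi_gt0 R.
have S0 : 0 <= S.
  by apply: le_trans (SK 0%N); do 2 (apply: sumr_ge0 => ? _).
have iW : mu.-integrable `[0, 2 * pi] (EFin \o (fun phi => `|W phi|)).
  by apply: continuous_itv_integrable => phi; apply: cvg_norm; exact: cW.
set A := \int[mu]_(phi in _) _.
have A0 : 0 <= A by exact: Rintegral_ge0.
have cst c : mu.-integrable `[0, 2 * pi] (EFin \o (fun=> c) : R -> \bar R).
  by apply: continuous_itv_integrable => phi; exact: cvg_cst.
have len : fine (mu `[0, 2 * pi]) = 2 * pi.
  by rewrite lebesgue_measure_itv/= lte_fin ifT ?sube0// mulr_gt0.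
pose c := 2 * Num.sqrt pi * S.
have c0 : 0 <= c by rewrite !mulr_ge0// sqrtr_ge0.
(* [e] is both the threshold of the sign and the error of the polynomial: 2 pi comes from the
   threshold, [A] from the replacement of [h] by [F], and [c] from |F| <= 1 + e. *)
have key e : 0 < e -> A <= c + e * (2 * pi + A + c).
  move=> e0; have [h [ch h1 hW]] := approximate_sign e0.
  have [F hF hFe] := weierstrass_disc (lt_trans r0 rr) (continuous_subspaceT ch) e0.
  have in_disc phi : closed_disc rad (polar r phi).
    rewrite /closed_disc/= -/(sqnorm (polar r phi)) sqnorm_polar.
    by rewrite lerXn2r ?nnegrE ?ltW// (lt_trans r0 rr).
  have F1 phi : `|F (polar r phi)| <= 1 + e.
    have -> : F (polar r phi) = h (polar r phi) - (h (polar r phi) - F (polar r phi)) by ring.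
    by rewrite (le_trans (ler_normB _ _))// lerD// hFe.
  have e1 : 0 <= 1 + e by rewrite addr_ge0// ltW.
  have := fourier_duality w_cont r_in hF e1 F1 SK.
  rewrite -/W => dual.
  have iWF : mu.-integrable `[0, 2 * pi] (EFin \o (fun phi => W phi * F (polar r phi))).
    apply: continuous_itv_integrable => phi.
    by apply: cvgM; [exact: cW|exact: hpoly_polar_continuous].
  have iWe : mu.-integrable `[0, 2 * pi] (EFin \o (fun phi => e * `|W phi|)).
    apply: continuous_itv_integrable => phi.
    by apply: cvgM; [exact: cvg_cst|apply: cvg_norm; exact: cW].
  have iWFe : mu.-integrable `[0, 2 * pi]
      (EFin \o (fun phi => W phi * F (polar r phi) + e * `|W phi|)).
    apply: continuous_itv_integrable => phi.
    apply: cvgD; first by apply: cvgM; [exact: cW|exact: hpoly_polar_continuous].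
    by apply: cvgM; [exact: cvg_cst|apply: cvg_norm; exact: cW].
  have iWFec : mu.-integrable `[0, 2 * pi]
      (EFin \o (fun phi => W phi * F (polar r phi) + e * `|W phi| + e)).
    apply: continuous_itv_integrable => phi.
    apply: cvgD; last exact: cvg_cst.
    apply: cvgD; first by apply: cvgM; [exact: cW|exact: hpoly_polar_continuous].
    by apply: cvgM; [exact: cvg_cst|apply: cvg_norm; exact: cW].
  have : A <= \int[mu]_(phi in `[0, 2 * pi]) (W phi * F (polar r phi) + e * `|W phi| + e).
    apply: le_Rintegral => // phi _; have := hW phi.
    have := hFe _ (in_disc phi); move: (h _) (F _) => x y xy.
    suff : W phi * x <= W phi * y + e * `|W phi| by lra.
    rewrite -lerBlDl -mulrBr (le_trans (ler_norm _))// normrM mulrC ler_wpM2r//.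
  rewrite RintegralD// RintegralD// RintegralZl// Rintegral_cst// len -/A.
  have := ler_norm (\int[mu]_(phi in `[0, 2 * pi]) (W phi * F (polar r phi))).
  rewrite /c; move: dual; move: (\int[mu]_(phi in _) _) => I.
  by rewrite -!mulrA; lra.
apply/ler_addgt0Pr => e e0.
have q0 : 0 < 2 * pi + A + c by rewrite !ltr_wpDr ?mulr_gt0.
have := key (e / (2 * pi + A + c)) (divr_gt0 e0 q0).
by rewrite divfK ?gt_eqF.
Qed.

(** The series may diverge at individual radii; there the right-hand side is +oo. The extended form
    can therefore be integrated over all r. *)
Lemma circle_L1_ebound :
  (\int[mu]_(phi in `[0%R, (2 * pi)%R]) `|W phi|%:E <=
   (2 * Num.sqrt pi)%:E *
   \sum_(0 <= k <oo) \sum_(1 <= l < (ang_dim k).+1) `|fcoef w k l r|%:E)%E.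
Proof.
set S := (\sum_(0 <= k <oo) _)%E.
have p0 := @pi_gt0 R.
have c0 : 0 < 2 * Num.sqrt pi :> R by rewrite mulr_gt0// sqrtr_gt0.
have t0 k : (0 <= \sum_(1 <= l < (ang_dim k).+1) `|fcoef w k l r|%:E)%E.
  by apply: sume_ge0 => l _; rewrite lee_fin.
have S0 : (0 <= S)%E by apply: nneseries_ge0.
have iW : mu.-integrable `[0, 2 * pi] (EFin \o (fun phi => `|W phi|)).
  by apply: continuous_itv_integrable => phi; apply: cvg_norm; exact: cW.
have [Soo|] := eqVneq S +oo%E; first by rewrite Soo gt0_muley ?leey// lte_fin.
rewrite -ltey => Slt.
have Sfin : S \is a fin_num by rewrite ge0_fin_numE.
have -> : (\int[mu]_(phi in `[0%R, (2 * pi)%R]) `|W phi|%:E =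
    (\int[mu]_(phi in `[0, 2 * pi]) `|W phi|)%:E)%E.
  by rewrite /Rintegral fineK//; exact: (integrable_fin_num _ iW).
rewrite -(fineK Sfin) -EFinM lee_fin; apply: circle_L1_bound => K.
rewrite -lee_fin fineK// -sumEFin; apply: le_trans (nneseries_lim_ge K.+1 _) => //.
by apply: lee_sum => k _; rewrite sumEFin.
Qed.

End circle_L1.

Section weight.
Context {R : realType}.
Notation mu := (@lebesgue_measure R).
Local Notation RR := (measurableTypeR R * measurableTypeR R)%type.
Notation mu2 := (@lebesgue_measure R \x @lebesgue_measure R)%E.
Variables (rad : R) (w : R * R -> R).
Hypothesis rad_gt0 : 0 < rad.
Hypothesis w_adm : admissible_weight rad w.

Let w_cont := weight_continuous w_adm.

Lemma open_disc_punctured : open_disc rad =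
  [set z | 0 < sqnorm z < rad ^+ 2] `|` [set (0, 0)].
Proof.
apply/seteqP; split => [z zr|z [/andP[_]//|->]]; last first.
  by rewrite /open_disc/= expr0n/= addr0 exprn_gt0.
have [z0|z0] := eqVneq z (0, 0); first by right.
left; apply/andP; split=> //; rewrite lt_neqAle sqnorm_ge0 andbT eq_sym.
apply: contra z0; rewrite /sqnorm paddr_eq0 ?sqr_ge0// !sqrf_eq0.
by case: z {zr} => x y /= /andP[/eqP -> /eqP ->].
Qed.

Lemma measurable_open_disc : measurable (open_disc rad : set RR).
Proof.
apply: open_measurable_plane.
rewrite (_ : open_disc rad = sqnorm @^-1` `]-oo, (rad ^+ 2)[%classic).
  by apply: open_comp; [move=> z _; exact: continuous_sqnorm|exact: interval_open].
by apply/seteqP; split=> z; rewrite /open_disc /sqnorm/= in_itv.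
Qed.

(** [w] may be discontinuous at the origin, which is split off as a measurable point. *)
Lemma measurable_weighted (G : R * R -> R) : continuous G ->
  measurable_fun (open_disc rad : set RR) (fun z => G z * w z).
Proof.
move=> cG; rewrite open_disc_punctured.
have oP : open [set z : R * R | 0 < sqnorm z < rad ^+ 2].
  rewrite (_ : [set z | _] = sqnorm @^-1` `]0, (rad ^+ 2)[%classic).
    by apply: open_comp; [move=> z _; exact: continuous_sqnorm|exact: interval_open].
  by apply/seteqP; split=> z; rewrite /= in_itv.
have m1 : measurable ([set (0, 0)] : set RR).
  rewrite (_ : [set _] = [set 0 : measurableTypeR R] `*` [set 0 : measurableTypeR R]).
    by apply: measurableX; exact: measurable_set1.
  by apply/seteqP; split=> [z -> //|[x y] [/= -> ->]].
apply/measurable_funU => //; first exact: open_measurable_plane.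
split; last exact: measurable_fun_set1.
apply: open_continuous_measurable_plane => // z /set_mem zP.
by apply: cvgM; [exact: cG|exact: (weight_continuous_at w_cont zP)].
Qed.

Let mw : measurable_fun (open_disc rad : set RR) w.
Proof.
rewrite (_ : w = fun z => 1 * w z); last by apply/funext => z; rewrite mul1r.
by apply: measurable_weighted => z; exact: cvg_cst.
Qed.

Lemma measurable_fcoef k l : (1 <= l <= ang_dim k)%N ->
  measurable_fun (`]0, rad[ : set (measurableTypeR R)) (fcoef w k l).
Proof.
move=> vl; apply: subspace_continuous_measurable_fun => //.
exact: (fcoef_continuous w_adm vl).
Qed.

Lemma polar_in_disc (r phi : R) : 0 < r -> (polar r phi \in open_disc rad) = (r < rad).
Proof.
move=> r0; have := sqnorm_polar r phi; rewrite /sqnorm => E.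
rewrite (_ : (r < rad) = (r ^+ 2 < rad ^+ 2)); last first.
  by rewrite ltr_pXn2r ?nnegrE ?(ltW r0) ?(ltW rad_gt0).
by apply/idP/idP => [/set_mem|H]; [|apply/mem_set]; rewrite /open_disc/= E.
Qed.

Lemma polar_pullback_disc (F : RR -> \bar R) (r phi : R) :
  polar_pullback (F \_ (open_disc rad)) (r, phi) =
  (if (r \in `]0%R, rad[) && (phi \in `]0%R, (2 * pi)%R[) then F (polar r phi) * r%:E else 0)%E.
Proof.
rewrite /polar_pullback patchE.
have -> : ((r, phi) \in polar_domain) = (0 < r) && (phi \in `]0, 2 * pi[).
  apply/idP/idP => [/set_mem[/=]|/andP[r0 phi0]].
    by rewrite [in X in X -> _]in_itv/= andbT => -> ->.
  by apply/mem_set; split => //=; rewrite in_itv/= r0.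
rewrite [r \in _]in_itv/=; case: ifPn => [/andP[r0 ->]|].
  rewrite r0 andbT /polar_density patchE/= polar_in_disc//=.
  by case: ifP => //; rewrite mul0e.
by case: (0 < r) => //= /negbTE ->; rewrite andbF.
Qed.

Let S r := (\sum_(0 <= k <oo) \sum_(1 <= l < (ang_dim k).+1) (`|fcoef w k l r| * r)%:E)%E.

Let term0 k r : 0 < r ->
  (0 <= \sum_(1 <= l < (ang_dim k).+1) (`|fcoef w k l r| * r)%:E)%E.
Proof. by move=> r0; apply: sume_ge0 => l _; rewrite lee_fin mulr_ge0// ltW. Qed.

Let S_pos r : 0 < r ->
  S r = (r%:E * \sum_(0 <= k <oo) \sum_(1 <= l < (ang_dim k).+1) `|fcoef w k l r|%:E)%E.
Proof.
move=> r0; rewrite -nneseriesZl; last by move=> k _; apply: sume_ge0 => l _; rewrite lee_fin.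
apply: eq_eseriesr => k _; rewrite ge0_sume_distrr; last by move=> l _; rewrite lee_fin.
by apply: eq_bigr => l _; rewrite -EFinM mulrC.
Qed.

Let mterm k l : (1 <= l < (ang_dim k).+1)%N ->
  measurable_fun (`]0, rad[ : set (measurableTypeR R)) (fun r => (`|fcoef w k l r| * r)%:E).
Proof.
move=> vl; apply/measurable_EFinP; apply: measurable_funM => //.
by apply: measurableT_comp => //; exact: measurable_fcoef.
Qed.

Let msum k :
  measurable_fun (`]0, rad[ : set (measurableTypeR R))
   (fun r => \sum_(1 <= l < (ang_dim k).+1) (`|fcoef w k l r| * r)%:E)%E.
Proof.
(* The guard is there because measurability is required of every summand, while [fcoef] is known to
   be continuous only for valid [l]. *)
rewrite (_ : (fun r => _) = fun r : R => (\sum_(l <- index_iota 1 (ang_dim k).+1)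
    (if (1 <= l < (ang_dim k).+1)%N then (`|fcoef w k l r| * r)%:E else 0))%E); last first.
  by apply/funext => r; rewrite big_nat big_mkcond.
apply: emeasurable_sum => l _; case: (boolP (1 <= l < _)%N) => [vl|_]; last exact: measurable_cst.
exact: mterm.
Qed.

Lemma integral_S : (\int[mu]_(r in `]0%R, rad[) S r)%E = weight_norm rad w.
Proof.
have ge0 k r : r \in `]0, rad[ -> (0 <= \sum_(1 <= l < (ang_dim k).+1) (`|fcoef w k l r| * r)%:E)%E.
  by rewrite in_itv/= => /andP[r0 _]; exact: term0.
rewrite /S integral_nneseries//.
apply: eq_eseriesr => k _.
transitivity (\int[mu]_(r in `]0%R, rad[) \sum_(l <- index_iota 1 (ang_dim k).+1)
    (if (1 <= l < (ang_dim k).+1)%N then (`|fcoef w k l r| * r)%:E else 0))%E.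
  by apply: eq_integral => r _; rewrite big_nat big_mkcond.
rewrite ge0_integral_sum//.
- rewrite [RHS]big_nat [RHS]big_mkcond; apply: eq_bigr => l _.
  by case: (1 <= l < _)%N => //; rewrite integral0.
- move=> l; case: (boolP (1 <= l < _)%N) => [vl|_]; last exact: measurable_cst.
  exact: mterm.
- move=> l r; rewrite /= in_itv/= => /andP[r0 _]; case: ifP => // _.
  by rewrite lee_fin mulr_ge0// ltW.
Qed.

(** [circle_L1_ebound] integrated against r dr. For |w|, polar coordinates and Tonelli hold in
    [0, +oo] without knowing integrability in advance. *)
Lemma weight_L1 :
  (\int[mu2]_(z in open_disc rad) `|w z|%:E <= (2 * Num.sqrt pi)%:E * weight_norm rad w)%E.
Proof.
pose F (z : RR) := (`|w z|%:E)%E; have p0 := @pi_gt0 R.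
have mF : measurable_fun setT (F \_ (open_disc rad)).
  apply/(measurable_restrictT F measurable_open_disc).
  by apply/measurable_EFinP; apply: measurableT_comp.
have F0 z : (0 <= (F \_ (open_disc rad)) z)%E.
  by rewrite patchE; case: ifP => // _; rewrite lee_fin.
rewrite integral_mkcond ge0_integral_polar_pullback//.
rewrite (@fubini_tonelli1 _ _ _ _ R (@lebesgue_measure R) (@lebesgue_measure R))//; first last.
- by move=> z; exact: polar_pullback_ge0.
- exact: measurable_polar_pullback.
have S0 r : r \in `]0, rad[ -> (0 <= S r)%E.
  by rewrite in_itv/= => /andP[r0 _]; apply: nneseries_ge0 => k _ _; exact: term0.
have mS : measurable_fun (`]0, rad[ : set (measurableTypeR R)) S.
  apply: (@ge0_emeasurable_sum _ _ _ _ _ xpredT) => // k r; rewrite /= in_itv/= => /andP[r0 _] _.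
  exact: term0.
have c0 : 0 <= 2 * Num.sqrt pi :> R by rewrite mulr_ge0// sqrtr_ge0.
rewrite -integral_S -ge0_integralZl ?lee_fin//.
rewrite [leRHS]integral_mkcond; apply: ge0_le_integral => //.
- by move=> r _; apply: integral_ge0 => phi _; exact: polar_pullback_ge0.
- apply: (@measurable_fun_fubini_tonelli_F _ _ _ _ R (@lebesgue_measure R)).
    exact: measurable_polar_pullback.
  by move=> z; exact: polar_pullback_ge0.
- apply/(measurable_restrictT (fun r => ((2 * Num.sqrt pi)%:E * S r)%E) (measurable_itv _)).
  exact: measurable_funeM.
- move=> r _; rewrite patchE /fubini_F; under eq_integral do rewrite polar_pullback_disc.
  rewrite mem_setE; case: ifPn => [rin|nrin]; last by rewrite integral0.
  have /andP[r0 rr] : 0 < r < rad by move: rin; rewrite in_itv.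
  rewrite S_pos// muleCA.
  apply: (@le_trans _ _ (r%:E * \int[mu]_(phi in `[0%R, (2 * pi)%R]) `|w (polar r phi)|%:E)%E).
    have cw : continuous (fun phi => `|w (polar r phi)|).
      move=> phi; apply: cvg_norm; apply: (weight_polar_continuous w_cont).
      by rewrite r0.
    rewrite -ge0_integralZl ?lee_fin ?(ltW r0)//; first last.
      by apply/measurable_EFinP/measurable_funTS; exact: continuous_measurable_fun.
    have -> : (\int[mu]_phi (if true && (phi \in `]0%R, (2 * pi)%R[)
          then F (polar r phi) * r%:E else 0) =
        \int[mu]_(phi in `]0%R, (2 * pi)%R[) (r%:E * `|w (polar r phi)|%:E))%E.
      rewrite [RHS]integral_mkcond; apply: eq_integral => phi _.
      by rewrite patchE mem_setE /= muleC.
    apply: ge0_subset_integral => //.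
    - apply/measurable_EFinP; apply: measurable_funM => //.
      by apply: measurable_funTS; exact: continuous_measurable_fun.
    - by move=> phi _; rewrite mule_ge0// lee_fin ltW.
    - exact: subset_itv_oo_cc.
  rewrite lee_wpmul2l ?lee_fin ?(ltW r0)//.
  by apply: (circle_L1_ebound w_cont); rewrite r0.
Qed.


Hypothesis w_sum : (weight_norm rad w < +oo)%E.

Lemma weight_norm_ge0 : (0 <= weight_norm rad w)%E.
Proof.
apply: nneseries_ge0 => k _ _; apply: sume_ge0 => l _; apply: integral_ge0 => r.
by rewrite /= in_itv/= => /andP[r0 _]; rewrite lee_fin mulr_ge0// ltW.
Qed.

Lemma weight_norm_fin_num : weight_norm rad w \is a fin_num.
Proof. by rewrite ge0_fin_numE// weight_norm_ge0. Qed.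

Lemma weight_integrable : mu2.-integrable (open_disc rad : set RR) (EFin \o w).
Proof.
apply/integrableP; split; first exact/measurable_EFinP.
apply: le_lt_trans weight_L1 _.
by rewrite -(fineK weight_norm_fin_num) -EFinM ltey.
Qed.

Lemma weighted_integrable (G : R * R -> R) B : continuous G ->
  (forall z, open_disc rad z -> `|G z| <= B) ->
  mu2.-integrable (open_disc rad : set RR) (EFin \o (fun z => G z * w z)).
Proof.
move=> cG GB.
have -> : EFin \o (fun z : RR => G z * w z) = ((EFin \o (fun z : RR => G z)) \* (EFin \o w))%E.
  by apply/funext => z.
apply: integrableMr => //; first exact: measurable_open_disc.
- apply: measurable_funTS; apply: open_continuous_measurable_plane; first exact: openT.
  by move=> z _; exact: cG.
- exists B; split; first by rewrite num_real.
  by move=> M BM z /GB GzB; exact: le_trans (ltW BM).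
- exact: weight_integrable.
Qed.

(** [weight_L1] read as continuity of the limit functional in the sup norm, with the constant that
    [sum_cubature_term_bound] has for the cubature. *)
Lemma weighted_integral_lip (F G : R * R -> R) B e : continuous F -> continuous G ->
  0 <= e ->
  (forall z, open_disc rad z -> `|F z| <= B) ->
  (forall z, open_disc rad z -> `|F z - G z| <= e) ->
  `|weighted_integral rad w F - weighted_integral rad w G| <=
  e * (2 * Num.sqrt pi * fine (weight_norm rad w)).
Proof.
move=> cF cG e0 FB FGe.
have GB z : open_disc rad z -> `|G z| <= B + e.
  move=> dz; have -> : G z = F z - (F z - G z) by ring.
  by rewrite (le_trans (ler_normB _ _))// lerD ?FB ?FGe.
have mD := measurable_open_disc.
have iF := weighted_integrable cF FB; have iG := weighted_integrable cG GB.
have cFG : continuous (fun z => F z - G z).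
  by move=> z; apply: cvgB; [exact: cF|exact: cG].
have iFG := weighted_integrable cFG FGe.
rewrite /weighted_integral -RintegralB//.
rewrite (_ : \int[mu2]_(x in _) _ = \int[mu2]_(x in open_disc rad) ((F x - G x) * w x)); last first.
  by apply: eq_Rintegral => z _; rewrite mulrBl.
apply: le_trans (le_normr_Rintegral mD iFG) _.
have iaw : mu2.-integrable (open_disc rad : set RR) (EFin \o (fun z => `|w z|)).
  exact: (integrable_abse weight_integrable).
apply: (@le_trans _ _ (\int[mu2]_(x in open_disc rad) (e * `|w x|))).
  apply: le_Rintegral => //.
  - exact: (integrable_abse iFG).
  - by apply: (integrableZl mD e iaw).
  - by move=> z dz; rewrite normrM ler_wpM2r// FGe.
rewrite RintegralZl// ler_wpM2l// -lee_fin EFinM (fineK weight_norm_fin_num).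
rewrite /Rintegral fineK; first exact: weight_L1.
exact: (integrable_fin_num mD iaw).
Qed.

(** In polar coordinates the angular integral is [fcoef] by definition; the last factor r is the
    Jacobian. *)
Lemma weighted_integral_solid k l s : (1 <= l <= ang_dim k)%N ->
  weighted_integral rad w (solid k l s) =
  \int[mu]_(r in `]0, rad[) (r ^+ (k + 2 * s) * (fcoef w k l r * r)).
Proof.
move=> vl; have mD := measurable_open_disc; have p0 := @pi_gt0 R.
have cE : continuous (@solid R k l s) := hpoly_continuous (hpoly_solid s vl).
have [B _ EcB] := closed_disc_bounded (ltW rad_gt0) cE.
have EB z : open_disc rad z -> `|@solid R k l s z| <= B by move=> dz; exact/EcB/ltW.
have iE := weighted_integrable cE EB.
pose F := (EFin \o (fun z : RR => solid k l s z * w z)) \_ (open_disc rad).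
have iF : mu2.-integrable setT F by exact/(integrable_mkcond _ mD).
rewrite /weighted_integral /Rintegral; congr fine.
rewrite integral_mkcond -/F integral_polar_pullback// [RHS]integral_mkcond.
apply: eq_integral => r _; under eq_integral do rewrite polar_pullback_disc.
rewrite patchE mem_setE; case: ifPn => [rin|nrin]; last by rewrite integral0.
have r_in : 0 < r < rad by move: rin; rewrite in_itv.
pose g phi := w (polar r phi) * harmonicY k l phi.
have cg : continuous g.
  move=> phi; apply: cvgM; first exact: (weight_polar_continuous w_cont r_in).
  exact: harmonicY_continuous.
have mg : measurable_fun setT g by exact: continuous_measurable_fun.
transitivity (\int[mu]_(phi in `]0%R, (2 * pi)%R[) ((r ^+ (k + 2 * s) * r)%:E * (g phi)%:E))%E.
  rewrite [RHS]integral_mkcond; apply: eq_integral => phi _; rewrite patchE mem_setE/=.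
  by case: ifP => // _; rewrite -!EFinM solid_polar /g; congr EFin; ring.
have ig : mu.-integrable `[0, 2 * pi] (EFin \o g) by exact: continuous_itv_integrable.
rewrite integralZl//; last first.
  apply: (@integrableS _ _ _ mu `[0, 2 * pi]) => //; exact: subset_itv_oo_cc.
rewrite integral_itv_bndo_bndc; last exact/measurable_EFinP/measurable_funTS.
rewrite integral_itv_obnd_cbnd; last exact/measurable_EFinP/measurable_funTS.
have -> : (\int[mu]_(x in `[0%R, (2 * pi)%R]) (g x)%:E = (fcoef w k l r)%:E)%E.
  rewrite /fcoef /Rintegral fineK//; exact: (integrable_fin_num _ ig).
by rewrite -EFinM; congr EFin; ring.
Qed.

End weight.

(** * Convergence of the cubature *)

Section nodes.
Context {R : realType}.
Notation mu := (@lebesgue_measure R).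

Lemma integral_sqr (rad : R) (g : R -> \bar R) : 0 < rad ->
  measurable_fun (`]0, rad ^+ 2[ : set (measurableTypeR R)) g ->
  (\int[mu]_(y in `]0%R, (rad ^+ 2)%R[) g y =
   \int[mu]_(r in `]0%R, rad[) (g (r ^+ 2)%R * (2 * r)%:E))%E.
Proof.
move=> rad0 mg; rewrite [LHS]integralE [RHS]integralE.
rewrite ge0_integral_sqr//; [|exact: measurable_funepos].
rewrite ge0_integral_sqr//; [|exact: measurable_funeneg].
congr (_ - _)%E; apply: eq_integral => r /set_mem; rewrite /= in_itv/= => /andP[r0 _].
  by rewrite !funeposE maxe_pMl ?mul0e ?lee_fin// mulr_ge0// ltW.
by rewrite !funenegE maxe_pMl ?mul0e ?mulNe ?lee_fin// mulr_ge0// ltW.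
Qed.

Variables (rad : R) (w : R * R -> R).
Hypothesis rad_gt0 : 0 < rad.
Hypothesis w_adm : admissible_weight rad w.

Definition fcoef_norm (k l : nat) : R :=
  \int[mu]_(r in `]0, rad[) (`|fcoef w k l r| * r).

Lemma fcoef_abs_integrable k l : (1 <= l <= ang_dim k)%N ->
  mu.-integrable `]0, rad[ (EFin \o (fun r => `|fcoef w k l r| * r)).
Proof.
move=> vl; apply/integrableP; split.
  apply/measurable_EFinP; apply: measurable_funM => //.
  by apply: measurableT_comp => //; exact: measurable_fcoef.
apply: le_lt_trans (fcoef_integrable w_adm vl).
rewrite le_eqVlt; apply/orP; left; apply/eqP; apply: eq_integral => r /set_mem.
rewrite /= in_itv/= => /andP[r0 _].
by rewrite /= ger0_norm// mulr_ge0// ltW.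
Qed.

Lemma fcoef_norm_ge0 k l : 0 <= fcoef_norm k l.
Proof.
apply: Rintegral_ge0 => r; rewrite /= in_itv/= => /andP[r0 _].
by rewrite mulr_ge0// ltW.
Qed.

Lemma fcoef_normE k l : (1 <= l <= ang_dim k)%N ->
  (\int[mu]_(r in `]0%R, rad[) (`|fcoef w k l r| * r)%:E = (fcoef_norm k l)%:E)%E.
Proof.
move=> vl; rewrite /fcoef_norm /Rintegral fineK//.
exact: (integrable_fin_num _ (fcoef_abs_integrable vl)).
Qed.

Lemma fcoef_moment_integrable n k l : (1 <= l <= ang_dim k)%N ->
  mu.-integrable `]0, rad[ (EFin \o (fun r => r ^+ n * (fcoef w k l r * r))).
Proof.
move=> vl; have mf := measurable_fcoef w_adm vl.
have -> : EFin \o (fun r => r ^+ n * (fcoef w k l r * r)) =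
    ((EFin \o (fun r : R => r ^+ n)%R) \* (EFin \o (fun r => fcoef w k l r * r)%R))%E.
  by apply/funext => r.
apply: integrableMr => //.
  exists (rad ^+ n); split; first by rewrite num_real.
  move=> M HM r /=; rewrite in_itv/= => /andP[r0 rr].
  apply: le_trans (ltW HM); rewrite ger0_norm ?exprn_ge0 ?(ltW r0)//.
  by rewrite lerXn2r ?nnegrE ?(ltW r0) ?(ltW rr) ?(ltW rad_gt0).
apply: le_integrable (fcoef_abs_integrable vl) => //.
  by apply/measurable_EFinP; apply: measurable_funM.
move=> r; rewrite /= in_itv/= => /andP[r0 _].
by rewrite lee_fin !normrM normr_id.
Qed.

Let W k l rho := fcoef w k l (Num.sqrt rho).

Let mW k l : (1 <= l <= ang_dim k)%N ->
  measurable_fun (`]0, rad ^+ 2[ : set (measurableTypeR R)) (W k l).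
Proof.
move=> vl.
apply: (@measurable_comp _ _ _ _ _ _ (`]0, rad[ : set (measurableTypeR R))) => //.
- move=> _ [rho /= + <-]; rewrite !in_itv/= => /andP[r0 rr].
  rewrite sqrtr_gt0 r0/= -(@ltr_pXn2r _ 2)// ?nnegrE ?sqrtr_ge0 ?(ltW rad_gt0)//.
  by rewrite sqr_sqrtr// ltW.
- exact: measurable_fcoef.
- apply: measurable_funTS; apply: continuous_measurable_fun; exact: sqrt_continuous.
Qed.

Let absW_int k l : (1 <= l <= ang_dim k)%N ->
  (\int[mu]_(rho in `]0%R, (rad ^+ 2)%R[) `|W k l rho|%:E = (2 * fcoef_norm k l)%:E)%E.
Proof.
move=> vl; rewrite integral_sqr//; last first.
  by apply/measurable_EFinP; apply: measurableT_comp => //; exact: mW.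
rewrite EFinM -fcoef_normE// -ge0_integralZl//.
- apply: eq_integral => r /set_mem; rewrite /= in_itv/= => /andP[r0 _].
  by rewrite /W sqrtr_sqr (gtr0_norm r0) -!EFinM; congr EFin; ring.
- apply/measurable_EFinP; apply: measurable_funM => //.
  by apply: measurableT_comp => //; exact: measurable_fcoef.
- by move=> r; rewrite /= in_itv/= => /andP[r0 _]; rewrite lee_fin mulr_ge0// ltW.
Qed.

Let intW k l : (1 <= l <= ang_dim k)%N ->
  mu.-integrable `]0, rad ^+ 2[ (EFin \o W k l).
Proof.
move=> vl; apply/integrableP; split; first by apply/measurable_EFinP; exact: mW.
by rewrite [X in (X < _)%E](absW_int vl) ltry.
Qed.

Let W_in k l (P : R -> Prop) : (forall r, 0 < r < rad -> P (fcoef w k l r)) ->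
  forall rho, 0 < rho < rad ^+ 2 -> P (W k l rho).
Proof.
move=> HP rho /andP[r0 rr]; apply: HP; rewrite sqrtr_gt0 r0/=.
rewrite -(@ltr_pXn2r _ 2)// ?nnegrE ?sqrtr_ge0 ?(ltW rad_gt0)//.
by rewrite sqr_sqrtr// ltW.
Qed.

Variables (k l N : nat) (t lam : 'I_N -> R).
Hypothesis vl : (1 <= l <= ang_dim k)%N.
Hypothesis N0 : (0 < N)%N.
Hypothesis data : gauss_data rad w k l t lam.

Lemma fcoef_zero_or :
  (exists2 r, 0 < r < rad & fcoef w k l r != 0) \/
  (forall r, 0 < r < rad -> fcoef w k l r = 0).
Proof.
have [H|H] := pselect (exists2 r, 0 < r < rad & fcoef w k l r != 0); [by left|right].
move=> r rin; apply/eqP; apply: contrapT => /negP nz.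
by apply: H; exists r.
Qed.

(** The factor 2 comes from d rho = 2 r dr. *)
Lemma gauss_weights_abs_le :
  (forall r, 0 < r < rad -> 0 <= fcoef w k l r) \/
  (forall r, 0 < r < rad -> fcoef w k l r <= 0) ->
  \sum_(j < N) `|lam j| * t j `^ (- (k%:R / 2)) <= 2 * fcoef_norm k l.
Proof.
move=> pd; have [t_in nz z] := data.
have [/nz[_ lamP ex]|/z lam0] := fcoef_zero_or; last first.
  rewrite big1 ?mulr_ge0 ?fcoef_norm_ge0// => j _.
  by rewrite lam0 normr0 mul0r.
have b0 : 0 < rad ^+ 2 by rewrite exprn_gt0.
have WE : \int[mu]_(rho in `]0, rad ^+ 2[) `|W k l rho| = 2 * fcoef_norm k l.
  by rewrite /Rintegral absW_int.
rewrite -WE; case: pd => pd.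
  have -> : \int[mu]_(rho in `]0, rad ^+ 2[) `|W k l rho| =
      \int[mu]_(rho in `]0, rad ^+ 2[) W k l rho.
    apply: eq_Rintegral => rho /set_mem; rewrite /= in_itv/= => rin.
    by rewrite ger0_norm// (@W_in k l (fun x => 0 <= x)).
  apply: gauss_weight_bound => //; first exact: intW.
  by move=> rho rin; apply: (@W_in k l (fun x => 0 <= x)).
(* Non-positive case: changing the sign of both the coefficient and the weights preserves exactness
   and reduces to the bound for a non-negative density. *)
have -> : \sum_(j < N) `|lam j| * t j `^ (- (k%:R / 2)) =
    \sum_(j < N) `|- lam j| * t j `^ (- (k%:R / 2)).
  by apply: eq_bigr => j _; rewrite normrN.
have -> : \int[mu]_(rho in `]0, rad ^+ 2[) `|W k l rho| =
    \int[mu]_(rho in `]0, rad ^+ 2[) (- W k l rho).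
  apply: eq_Rintegral => rho /set_mem; rewrite /= in_itv/= => rin.
  by rewrite ler0_norm// (@W_in k l (fun x => x <= 0)).
apply: (@gauss_weight_bound _ _ _ _ (fun rho => - W k l rho) t (fun j => - lam j)) => //.
- have -> : EFin \o (fun rho => - W k l rho) = (\- (EFin \o W k l))%E.
    by apply/funext => rho.
  by apply: integrableN; exact: intW.
- move=> s sN; under eq_bigr do rewrite mulNr.
  rewrite sumrN ex//; under [RHS]eq_Rintegral do rewrite mulrN mulrN -mulN1r.
  rewrite RintegralZl ?mulN1r//; apply: moment_integrable => //; exact: intW.
- by move=> rho rin; rewrite oppr_ge0 (@W_in k l (fun x => x <= 0)).
- by case: lamP => lamP; [right|left] => j; rewrite ?oppr_lt0 ?oppr_gt0.
Qed.

(** Under rho = r^2, rho^s rho^(k/2) d rho becomes 2 r^(k+2s) r dr. When the coefficient vanishes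
    identically both sides are 0. *)
Lemma gauss_exact s : (s <= 2 * N - 1)%N ->
  \sum_(j < N) lam j * t j ^+ s =
  2 * \int[mu]_(r in `]0, rad[) (r ^+ (k + 2 * s) * (fcoef w k l r * r)).
Proof.
move=> sN; have [t_in nz z] := data.
have [/nz[_ _ ex]|z0] := fcoef_zero_or; last first.
  rewrite big1; last by move=> j _; rewrite z// mul0r.
  have -> : \int[mu]_(r in `]0, rad[) (r ^+ (k + 2 * s) * (fcoef w k l r * r)) =
      \int[mu]_(r in `]0, rad[) 0.
    by apply: eq_Rintegral => r /set_mem; rewrite /= in_itv/= => rin; rewrite z0// mul0r mulr0.
  by rewrite Rintegral_cst// mul0r mulr0.
rewrite ex// -RintegralZl//; last exact: fcoef_moment_integrable.
rewrite /Rintegral integral_sqr//; last first.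
  apply: (measurable_int mu); apply: moment_integrable; last exact: intW.
  by rewrite exprn_gt0.
congr fine; apply: eq_integral => r /set_mem; rewrite /= in_itv/= => /andP[r0 _].
rewrite -EFinM powR_half_nat ?sqr_ge0// sqrtr_sqr (gtr0_norm r0); congr EFin.
by rewrite exprD -exprM mulnC; ring.
Qed.

End nodes.

Lemma nneseries_tail (R : realType) (b : nat -> R) (A e : R) :
  (forall k, 0 <= b k) -> (\sum_(0 <= k <oo) (b k)%:E = A%:E)%E -> 0 < e ->
  exists n, forall K, \sum_(n <= k < K) b k <= e.
Proof.
move=> b0 bA e0.
have b0E k : (0 <= (b k)%:E)%E by rewrite lee_fin.
have le K : \sum_(0 <= k < K) b k <= A.
  by rewrite -lee_fin -bA -sumEFin; exact: nneseries_lim_ge.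
have [n An] : exists n, A - e < \sum_(0 <= k < n) b k.
  apply: contrapT => /forallNP H.
  suff : (A%:E <= (A - e)%:E)%E by rewrite lee_fin lerBrDr gerDl leNgt e0.
  rewrite -bA; apply: lime_le.
    by apply: is_cvg_ereal_nneg_natsum_cond => k _ _.
  apply: nearW => n; rewrite sumEFin lee_fin leNgt; exact/negP/H.
exists n => K; have [Kn|nK] := leqP K n; first by rewrite big_geq// ltW.
have := le K; rewrite (big_cat_nat _ (ltnW nK))//=; lra.
Qed.

Unset Implicit Arguments.
Section convergence.
Context {R : realType}.
Variables (rad : R) (w : R * R -> R).
Variables (t lam : forall N : nat, nat -> nat -> 'I_N -> R).
Hypothesis rad_gt0 : 0 < rad.
Hypothesis w_adm : admissible_weight rad w.
Hypothesis w_pd : pseudo_definite rad w.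
Hypothesis gaussP : forall N k l : nat, (1 <= N)%N -> (1 <= l <= ang_dim k)%N ->
  gauss_data rad w k l (t N k l) (lam N k l).
Hypothesis w_sum : (weight_norm rad w < +oo)%E.
Set Implicit Arguments.

Let A := fine (weight_norm rad w).
Let b k := \sum_(1 <= l < (ang_dim k).+1) fcoef_norm rad w k l.

Let A0 : 0 <= A.
Proof. by apply: fine_ge0; exact: weight_norm_ge0. Qed.

Let b0 k : 0 <= b k.
Proof. by apply: sumr_ge0 => l _; exact: fcoef_norm_ge0. Qed.

Let sum_b : (\sum_(0 <= k <oo) (b k)%:E = A%:E)%E.
Proof.
rewrite /A fineK; last exact: weight_norm_fin_num.
apply: eq_eseriesr => k _; rewrite /b -sumEFin big_nat [RHS]big_nat.
by apply: eq_bigr => l vl; rewrite -fcoef_normE.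
Qed.

(** The (k,l) part of the cubature. The factor 1/2 compensates for the weight 2 pi / M in
    [sample_sum]. *)
Definition cubature_term N M k l (f : R * R -> R) : R :=
  2^-1 * \sum_(j < N) lam N k l j * t N k l j `^ (- (k%:R / 2)) *
    sample_sum M (fun phi => f (polar (Num.sqrt (t N k l j)) phi)) k l.

Lemma poly_cubatureE N M K f :
  poly_cubature t lam N M K f =
  \sum_(0 <= k < K.+1) \sum_(1 <= l < (ang_dim k).+1) cubature_term N M k l f.
Proof.
rewrite /poly_cubature mulr_sumr; apply: eq_bigr => k _.
rewrite mulr_sumr; apply: eq_bigr => l _.
rewrite /cubature_term !mulr_sumr; apply: eq_bigr => j _.
rewrite /sample_sum !mulr_sumr; apply: eq_bigr => s _.
have -> : pi / M%:R = 2^-1 * (2 * pi / M%:R) :> R by rewrite !mulrA mulVf ?mul1r.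
by ring.
Qed.

Lemma cubature_termD N M k l f g :
  cubature_term N M k l (fun z => f z + g z) =
  cubature_term N M k l f + cubature_term N M k l g.
Proof.
rewrite /cubature_term -mulrDr -big_split/=; congr (_ * _); apply: eq_bigr => j _.
rewrite -mulrDr /sample_sum -mulrDr -big_split/=; congr (_ * (_ * _)).
by apply: eq_bigr => s _; rewrite mulrDl.
Qed.

Lemma cubature_termZ N M k l c f :
  cubature_term N M k l (fun z => c * f z) = c * cubature_term N M k l f.
Proof.
rewrite /cubature_term mulrCA; congr (_ * _); rewrite mulr_sumr.
apply: eq_bigr => j _; rewrite [RHS]mulrCA; congr (_ * _).
rewrite /sample_sum [RHS]mulrCA; congr (_ * _); rewrite mulr_sumr.
by apply: eq_bigr => s _; rewrite mulrA.
Qed.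

Lemma poly_cubatureD N M K f g :
  poly_cubature t lam N M K (fun z => f z + g z) =
  poly_cubature t lam N M K f + poly_cubature t lam N M K g.
Proof.
rewrite !poly_cubatureE -big_split/=; apply: eq_bigr => k _.
by rewrite -big_split/=; apply: eq_bigr => l _; exact: cubature_termD.
Qed.

Lemma poly_cubatureZ N M K c f :
  poly_cubature t lam N M K (fun z => c * f z) = c * poly_cubature t lam N M K f.
Proof.
rewrite !poly_cubatureE mulr_sumr; apply: eq_bigr => k _.
by rewrite mulr_sumr; apply: eq_bigr => l _; exact: cubature_termZ.
Qed.

Lemma node_in_disc N k l j phi : (1 <= N)%N -> (1 <= l <= ang_dim k)%N ->
  closed_disc rad (polar (Num.sqrt (t N k l j)) phi).
Proof.
move=> N1 vl; have [t_in _ _] := gaussP N k l N1 vl; have /andP[t0 tr] := t_in j.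
rewrite /closed_disc/= -/(sqnorm (polar _ phi)) sqnorm_polar.
by rewrite sqr_sqrtr ltW.
Qed.

(** Uniform in [N] and [M]: the factor 1/2 meets the factor 2 of [gauss_weights_abs_le], and
    [sample_sum_bound] supplies the rest. *)
Lemma cubature_term_bound N M k l f B : (1 <= N)%N -> (1 <= l <= ang_dim k)%N ->
  0 <= B -> (forall z, closed_disc rad z -> `|f z| <= B) ->
  `|cubature_term N M k l f| <= 2 * Num.sqrt pi * B * fcoef_norm rad w k l.
Proof.
move=> N1 vl B0 fB.
have gb := gauss_weights_abs_le rad_gt0 w_adm vl N1 (gaussP N k l N1 vl) (w_pd k l vl).
have c0 : 0 <= 2 * Num.sqrt pi * B by rewrite !mulr_ge0// sqrtr_ge0.
rewrite /cubature_term normrM ger0_norm ?invr_ge0// mulrC ler_pdivrMr//.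
apply: (@le_trans _ _ (\sum_(j < N) (`|lam N k l j| * t N k l j `^ (- (k%:R / 2))) *
    (2 * Num.sqrt pi * B))).
  rewrite (le_trans (ler_norm_sum _ _ _))//; apply: ler_sum => j _.
  rewrite normrM [X in X * _]normrM (ger0_norm (powR_ge0 _ _)) ler_wpM2l ?mulr_ge0 ?powR_ge0//.
  by apply: sample_sum_bound => // phi; apply: fB; exact: node_in_disc.
by rewrite -mulr_suml [leLHS]mulrC -[leRHS]mulrA ler_wpM2l// [leRHS]mulrC.
Qed.

Lemma sum_cubature_term_bound N M m K f B : (1 <= N)%N -> 0 <= B ->
  (forall z, closed_disc rad z -> `|f z| <= B) ->
  `|\sum_(m <= k < K) \sum_(1 <= l < (ang_dim k).+1) cubature_term N M k l f| <=
  2 * Num.sqrt pi * B * \sum_(m <= k < K) b k.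
Proof.
move=> N1 B0 fB; rewrite mulr_sumr (le_trans (ler_norm_sum _ _ _))//.
apply: ler_sum => k _; rewrite mulr_sumr (le_trans (ler_norm_sum _ _ _))//.
rewrite big_nat [leRHS]big_nat; apply: ler_sum => l vl.
exact: cubature_term_bound.
Qed.

(** Orthogonality leaves only (k,l) = (k',l'), where t^(-k/2) sqrt(t)^(k+2s) = t^s is within the
    range of Gauss exactness. *)
Lemma cubature_term_solid N M k l k' l' s : (1 <= N)%N ->
  (1 <= l <= ang_dim k)%N -> (1 <= l' <= ang_dim k')%N ->
  (s <= 2 * N - 1)%N -> (k + k' < M)%N ->
  cubature_term N M k l (solid k' l' s) =
  ((k == k') && (l == l'))%:R * weighted_integral rad w (solid k' l' s).
Proof.
move=> N1 vl vl' sN kM; have [t_in _ _] := gaussP N k l N1 vl.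
rewrite /cubature_term.
have E j : sample_sum M (fun phi => solid k' l' s (polar (Num.sqrt (t N k l j)) phi)) k l =
    Num.sqrt (t N k l j) ^+ (k' + 2 * s) * ((k == k') && (l == l'))%:R.
  rewrite -(@discrete_orthogonality R k l k' l' M)//.
  rewrite /sample_sum mulrCA; congr (_ * _); rewrite mulr_sumr.
  by apply: eq_bigr => i _; rewrite solid_polar; ring.
under eq_bigr do rewrite E.
have [/andP[/eqP kk /eqP ll]|_] := boolP ((k == k') && (l == l')); last first.
  by rewrite mul0r big1 ?mulr0// => j _; rewrite !mulr0.
rewrite -kk -ll mul1r weighted_integral_solid//.
apply: (mulfI (_ : 2 != 0)) => //.
rewrite mulrA mulfV// mul1r -(gauss_exact rad_gt0 w_adm vl (gaussP N k l N1 vl) sN).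
apply: eq_bigr => j _; have /andP[t0 _] := t_in j.
rewrite mulr1 -mulrA; congr (_ * _).
rewrite powRN powR_half_nat ?(ltW t0)// exprD mulKf; last first.
  by rewrite expf_neq0// gt_eqF// sqrtr_gt0.
by rewrite exprM sqr_sqrtr// ltW.
Qed.

Definition eventually_close (f : R * R -> R) := forall e, 0 < e -> exists n0 : nat,
  forall N M K, (n0 <= N)%N -> (n0 <= M)%N -> (n0 <= K)%N ->
  `|poly_cubature t lam N M K f - weighted_integral rad w f| <= e.

(** The series is cut at an index fixed before [M] and [K], so [M] need not grow with [K]: beyond
    the cut, terms are bounded whether they are aliased or not. *)
Lemma eventually_close_solid k' l' s : (1 <= l' <= ang_dim k')%N ->
  eventually_close (solid k' l' s).
Proof.
move=> vl' e e0.
have cE : continuous (@solid R k' l' s) := hpoly_continuous (hpoly_solid s vl').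
have [B B0 EB] := closed_disc_bounded (ltW rad_gt0) cE.
have p0 := @pi_gt0 R.
have c0 : 0 < 2 * Num.sqrt pi * B by rewrite !mulr_gt0// sqrtr_gt0.
have [n tail] := nneseries_tail b0 sum_b (divr_gt0 e0 c0).
(* A generous common threshold: it gives s <= 2N - 1, m <= K + 1, and k + k' < M for every k < m. *)
exists (s + n + k' + k' + 2)%N => N M K nN nM nK.
have N1 : (1 <= N)%N by lia.
have sN : (s <= 2 * N - 1)%N by lia.
(* Past [k'], so that the matching term lies below the cut, and past [n], so that the tail of the
   norm is small. *)
pose m := maxn n k'.+1.
rewrite poly_cubatureE (@big_cat_nat _ _ _ m)//=; last by rewrite /m; lia.
have -> : \sum_(0 <= k < m) \sum_(1 <= l < (ang_dim k).+1) cubature_term N M k l (solid k' l' s) =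
    weighted_integral rad w (solid k' l' s).
  have k'm : (k' < m)%N by rewrite /m; lia.
  have E k l : (k < m)%N -> (1 <= l <= ang_dim k)%N ->
      cubature_term N M k l (solid k' l' s) =
      ((k == k') && (l == l'))%:R * weighted_integral rad w (solid k' l' s).
    by move=> km vl; apply: cubature_term_solid => //; rewrite /m in km; lia.
  rewrite big_mkord (bigD1 (Ordinal k'm))//= [X in _ + X]big1 ?addr0; last first.
    move=> i ik'; rewrite big_nat big1// => l vl; rewrite E//.
    by rewrite (_ : (i == k' :> nat) = false) ?mul0r//; exact/negbTE.
  rewrite (bigD1_seq l') ?iota_uniq ?mem_index_iota//= E// !eqxx mul1r.
  rewrite big1_seq ?addr0// => l /andP[ll']; rewrite mem_index_iota => vl.
  by rewrite E// (negbTE ll') andbF mul0r.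
rewrite addrAC subrr add0r.
rewrite (le_trans (sum_cubature_term_bound _ _ _ N1 (ltW B0) EB))//.
rewrite mulrC -ler_pdivlMr//.
apply: le_trans (tail K.+1).
have [nk|nk] := leqP m K.+1; last by rewrite big_geq ?(ltnW nk)// sumr_ge0.
rewrite [leRHS](@big_cat_nat _ _ _ m)//=; last by rewrite /m leq_maxl.
by rewrite lerDr sumr_ge0.
Qed.

Lemma eventually_close_hpoly F : hpoly F -> eventually_close F.
Proof.
elim=> {F} [k l s vl|F G hF HF hG HG|c F hF HF] e e0.
- exact: eventually_close_solid.
- have e2 : 0 < e / 2 by rewrite divr_gt0.
  have [n1 H1] := HF _ e2; have [n2 H2] := HG _ e2.
  have cF := hpoly_continuous hF; have cG := hpoly_continuous hG.
  have [B1 _ FB] := closed_disc_bounded (ltW rad_gt0) cF.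
  have [B2 _ GB] := closed_disc_bounded (ltW rad_gt0) cG.
  exists (maxn n1 n2) => N M K; rewrite !geq_max => /andP[? ?] /andP[? ?] /andP[? ?].
  have -> : weighted_integral rad w (fun z => F z + G z) =
      weighted_integral rad w F + weighted_integral rad w G.
    rewrite /weighted_integral -RintegralD//.
    + by apply: eq_Rintegral => z _; rewrite mulrDl.
    + exact: measurable_open_disc.
    + by apply: (weighted_integrable rad_gt0 w_adm w_sum cF (B := B1)) => z dz; exact/FB/ltW.
    + by apply: (weighted_integrable rad_gt0 w_adm w_sum cG (B := B2)) => z dz; exact/GB/ltW.
  rewrite poly_cubatureD opprD addrACA [leRHS]splitr.
  by rewrite (le_trans (ler_normD _ _))// lerD// ?H1 ?H2.
- have c1 : 0 < `|c| + 1 by rewrite ltr_wpDl.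
  have [n0 H] := HF _ (divr_gt0 e0 c1).
  have cF := hpoly_continuous hF.
  have [B1 _ FB] := closed_disc_bounded (ltW rad_gt0) cF.
  exists n0 => N M K nN nM nK.
  have -> : weighted_integral rad w (fun z => c * F z) = c * weighted_integral rad w F.
    rewrite /weighted_integral -RintegralZl//.
    + by apply: eq_Rintegral => z _; rewrite mulrA.
    + exact: measurable_open_disc.
    + by apply: (weighted_integrable rad_gt0 w_adm w_sum cF (B := B1)) => z dz; exact/FB/ltW.
  rewrite poly_cubatureZ -mulrBr normrM.
  apply: (@le_trans _ _ ((`|c| + 1) * (e / (`|c| + 1)))).
    by rewrite ler_pM// ?lerDl// H.
  by rewrite mulrCA mulfV ?mulr1// gt_eqF.
Qed.

Lemma eventually_close_continuous f : continuous f -> eventually_close f.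
Proof.
move=> cf e e0.
pose c := 2 * Num.sqrt pi * A.
have c0 : 0 <= c by rewrite !mulr_ge0// sqrtr_ge0.
(* Replacing [f] by [F] costs at most d c in the cubature and d c in the integral; the limit for [F]
   costs d. *)
pose d := e / (2 * c + 1).
have c1 : 0 < 2 * c + 1 by rewrite ltr_wpDl// mulr_ge0.
have d0 : 0 < d by rewrite divr_gt0.
have [F hF fF] := weierstrass_disc rad_gt0 (continuous_subspaceT cf) d0.
have [n0 H] := eventually_close_hpoly hF d0.
have cF := hpoly_continuous hF.
have [B1 _ fB] := closed_disc_bounded (ltW rad_gt0) cf.
(* The successor makes [N] positive, as the Gauss data are given only then. *)
exists n0.+1 => N M K nN nM nK.
have N1 : (1 <= N)%N by exact: leq_ltn_trans nN.
have I1 : `|weighted_integral rad w f - weighted_integral rad w F| <= d * c.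
  apply: (weighted_integral_lip rad_gt0 w_adm w_sum cf cF (ltW d0) (B := B1)) => z dz.
    exact/fB/ltW.
  exact/fF/ltW.
have I2 : `|poly_cubature t lam N M K f - poly_cubature t lam N M K F| <= d * c.
  rewrite -mulN1r -poly_cubatureZ -poly_cubatureD poly_cubatureE.
  have fFB z : closed_disc rad z -> `|f z + -1 * F z| <= d.
    by move=> dz; rewrite mulN1r fF.
  rewrite (le_trans (sum_cubature_term_bound _ _ _ N1 (ltW d0) fFB))//.
  rewrite mulrAC [leRHS]mulrC ler_wpM2r ?(ltW d0)// ler_wpM2l ?mulr_ge0 ?sqrtr_ge0//.
  rewrite -lee_fin -sum_b -sumEFin; apply: nneseries_lim_ge => k _.
  by rewrite lee_fin.
have I3 := H N M K (ltnW nN) (ltnW nM) (ltnW nK).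
have -> : poly_cubature t lam N M K f - weighted_integral rad w f =
  (poly_cubature t lam N M K f - poly_cubature t lam N M K F) +
  (poly_cubature t lam N M K F - weighted_integral rad w F) -
  (weighted_integral rad w f - weighted_integral rad w F) by ring.
rewrite (le_trans (ler_normB _ _))// (@le_trans _ _ (d * c + d + d * c))//.
  by rewrite lerD// (le_trans (ler_normD _ _))// lerD.
rewrite (_ : _ + _ = d * (2 * c + 1)); last by ring.
by rewrite /d divfK// gt_eqF.
Qed.

End convergence.

Unset Implicit Arguments.
Set Strict Implicit.
Set Printing Implicit Defensive.

Theorem corollary3 (R : realType) (rad : R) (w : R * R -> R)
    (t lam : forall N : nat, nat -> nat -> 'I_N -> R)
    (rad_gt0 : 0 < rad)
    (w_adm : admissible_weight rad w)
    (w_pd : pseudo_definite rad w)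
    (gaussP : forall N k l : nat, (1 <= N)%N -> (1 <= l <= ang_dim k)%N ->
       gauss_data rad w k l (t N k l) (lam N k l))
    (w_sum : (weight_norm rad w < +oo)%E)
    (f : R * R -> R)
    (f_cont : {within closed_disc rad, continuous f}) :
  (fun p : nat * nat * nat => poly_cubature t lam p.1.1 p.1.2 p.2 f)
    @ (filter_prod (filter_prod \oo \oo) \oo) --> weighted_integral rad w f.
Proof.
move=> /=; pose g := f \o disc_retract rad.
have cg : continuous g by exact: continuous_comp_disc_retract.
have fg z : closed_disc rad z -> f z = g z.
  by move=> dz; rewrite /g /= disc_retract_id.
(* The domain of integration and all the nodes lie in the closed disc, so neither functional sees
   the extension outside it. *)
have -> : weighted_integral rad w f = weighted_integral rad w g.
  by apply: eq_Rintegral => z /set_mem dz; rewrite fg//; exact: ltW.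
apply/cvgrPdist_le => e e0.
have [n0 H] := eventually_close_continuous rad_gt0 w_adm w_pd gaussP w_sum cg e0.
exists ([set q : nat * nat | (n0.+1 <= q.1)%N /\ (n0 <= q.2)%N], [set K | (n0 <= K)%N]).
  split; last exact: nbhs_infty_ge.
  exists ([set N | (n0.+1 <= N)%N], [set M | (n0 <= M)%N]).
    by split; exact: nbhs_infty_ge.
  by move=> [N M].
move=> [[N M] K] /= [[nN nM] nK].
have N1 : (1 <= N)%N by exact: leq_trans nN.
rewrite distrC; have -> : poly_cubature t lam N M K f = poly_cubature t lam N M K g.
  rewrite !poly_cubatureE; apply: eq_bigr => k _; rewrite big_nat [RHS]big_nat.
  apply: eq_bigr => l vl; rewrite /cubature_term; congr (_ * _).
  apply: eq_bigr => j _; congr (_ * _); rewrite /sample_sum; congr (_ * _).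
  by apply: eq_bigr => i _; rewrite fg//; exact: (node_in_disc gaussP).
exact: H (ltnW nN) nM nK.
Qed.
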